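(* The poset of finite smooth digraphs ordered by pp-constructability is a complete lattice and a distributive lattice.
   Context: All structures are nonempty. A smooth digraph is a directed graph (loops allowed) in which every vertex has an incoming and an outgoing edge. Pp-constructability. For a relational structure $\mathbb{A}$ with domain $A$, a pp-power of $\mathbb{A}$ is a structure isomorphic to one with domain $A^n$, $n\in\mathbb{N}^+$, all of whose relations are definable in $\mathbb{A}$ by primitive positive formulas (existentially quantified conjunctions of atomic formulas, equality allowed), where a $k$-ary relation on $A^n$ is regarded as a $kn$-ary relation on $A$. $\mathbb{A}\leq\mathbb{B}$ (''$\mathbb{A}$ pp-constructs $\mathbb{B}$'') means that $\mathbb{B}$ is homomorphically equivalent (homomorphisms in both directions) to a pp-power of $\mathbb{A}$. This is a quasi-order; $[\mathbb{A}]$ denotes the class of $\mathbb{A}$ under $\mathbb{A}\equiv\mathbb{B}:\Leftrightarrow\mathbb{A}\leq\mathbb{B}\leq\mathbb{A}$. The poset in question consists of the classes $[\mathbb{G}]$ of finite smooth digraphs $\mathbb{G}$, ordered by $[\mathbb{G}]\leq[\mathbb{H}]$ iff $\mathbb{G}\leq\mathbb{H}$. ''Distributive'' refers to the binary (finite) distributive law. *)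

(* Defs.v *)
From mathcomp Require Import all_boot.
From Stdlib Require Relation_Definitions.
From Stdlib Require List.

Set Implicit Arguments.
Unset Strict Implicit.
Unset Printing Implicit Defensive.

Record signature := Signature {
  symbol : Type;
  arity : symbol -> nat }.

Record structure (sigma : signature) := Structure {
  domain :> Type;
  interp : forall s : symbol sigma, (arity s).-tuple domain -> Prop;
  domain_inhabited : inhabited domain }.

Section Morphisms.
Variable sigma : signature.
Implicit Types A B : structure sigma.

Definition homomorphism A B (f : A -> B) : Prop :=
  forall (s : symbol sigma) (t : (arity s).-tuple A),
    interp t -> interp (map_tuple f t).

Definition isomorphism A B (f : A -> B) : Prop :=
  bijective f /\
  forall (s : symbol sigma) (t : (arity s).-tuple A),
    interp t <-> interp (map_tuple f t).

Definition isomorphic A B : Prop := exists f : A -> B, isomorphism f.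

Definition hom_equivalent A B : Prop :=
  (exists f : A -> B, homomorphism f) /\ (exists g : B -> A, homomorphism g).

End Morphisms.

Inductive atomic (sigma : signature) (X : Type) : Type :=
| AtomRel (s : symbol sigma) (args : (arity s).-tuple X)
| AtomEq (x y : X).

(** The free variables are the elements of [X]; the [bound_vars]-many
    existentially quantified variables are the elements of ['I_bound_vars]. *)
Record pp_formula (sigma : signature) (X : Type) := PPFormula {
  bound_vars : nat;
  conjuncts : seq (atomic sigma (X + 'I_bound_vars)) }.

Definition atomic_holds (sigma : signature) (A : structure sigma) (X : Type)
    (v : X -> A) (a : atomic sigma X) : Prop :=
  match a with
  | AtomRel s args => interp (map_tuple v args)
  | AtomEq x y => v x = v y
  end.

Definition pp_holds (sigma : signature) (A : structure sigma) (X : Type)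
    (v : X -> A) (phi : pp_formula sigma X) : Prop :=
  exists w : 'I_(bound_vars phi) -> A,
    List.Forall
      (atomic_holds (fun z => match z with inl x => v x | inr i => w i end))
      (conjuncts phi).

(** A [k]-ary relation on [A^n] is regarded as a [kn]-ary relation on [A]: the
    free variable [(i, j)] stands for the [j]-th entry of the [i]-th argument. *)
Definition pp_definable (sigma : signature) (A : structure sigma) (n k : nat)
    (R : k.-tuple (n.-tuple A) -> Prop) : Prop :=
  exists phi : pp_formula sigma ('I_k * 'I_n),
    forall t : k.-tuple (n.-tuple A),
      R t <-> pp_holds (fun p => tnth (tnth t p.1) p.2) phi.

Definition pp_power (sigma tau : signature)
    (A : structure sigma) (B : structure tau) : Prop :=
  exists n : nat, 0 < n /\
  exists (R : forall s : symbol tau, (arity s).-tuple (n.-tuple A) -> Prop)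
         (inh : inhabited (n.-tuple A)),
    (forall s : symbol tau, pp_definable (R s)) /\
    isomorphic (Structure R inh) B.

Definition pp_constructs (sigma tau : signature)
    (A : structure sigma) (B : structure tau) : Prop :=
  exists C : structure tau, pp_power A C /\ hom_equivalent B C.

Record digraph := Digraph {
  vertex : finType;
  edge : rel vertex;
  vertex_inhabited : inhabited vertex }.

Definition smooth (G : digraph) : Prop :=
  forall v : vertex G, (exists u, edge u v) /\ (exists w, edge v w).

Record smooth_digraph := SmoothDigraph {
  smooth_graph :> digraph;
  smooth_graphP : smooth smooth_graph }.

Definition digraph_signature : signature := Signature (fun _ : unit => 2).

Definition digraph_structure (G : digraph) : structure digraph_signature :=
  @Structure digraph_signature (vertex G)
    (fun _ (t : 2.-tuple (vertex G)) => edge (tnth t ord0) (tnth t ord_max))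
    (vertex_inhabited G).

Coercion digraph_structure : digraph >-> structure.

Definition pp_class (G : smooth_digraph) : smooth_digraph -> Prop :=
  fun H => pp_constructs G H /\ pp_constructs H G.

Definition smooth_digraph_class : Type :=
  {c : smooth_digraph -> Prop | exists G : smooth_digraph, c = pp_class G}.

Definition class_le (c d : smooth_digraph_class) : Prop :=
  exists G H : smooth_digraph,
    [/\ sval c = pp_class G, sval d = pp_class H & pp_constructs G H].

Section Lattices.
Variables (T : Type) (le : T -> T -> Prop).

Definition is_lub (S : T -> Prop) (x : T) : Prop :=
  (forall y, S y -> le y x) /\
  (forall z, (forall y, S y -> le y z) -> le x z).

Definition is_glb (S : T -> Prop) (x : T) : Prop :=
  (forall y, S y -> le x y) /\
  (forall z, (forall y, S y -> le z y) -> le z x).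

Definition complete_lattice : Prop :=
  Relation_Definitions.order T le /\
  forall S : T -> Prop, (exists x, is_lub S x) /\ (exists x, is_glb S x).

Definition distributive_lattice : Prop :=
  Relation_Definitions.order T le /\
  exists meet join : T -> T -> T,
    [/\ forall x y, is_glb (fun z => z = x \/ z = y) (meet x y),
        forall x y, is_lub (fun z => z = x \/ z = y) (join x y)
      & right_distributive meet join].

End Lattices.

(* Main.v *)
From mathcomp Require Import all_boot.
From mathcomp Require Import zify.
From mathcomp.classical Require Import boolp.
Require Import Defs.

(** By a theorem of Barto, Kozik and Niven, a finite smooth digraph either has a
    minion homomorphism from its polymorphisms to the projections, and then
    pp-constructs every finite digraph, or is homomorphically equivalent to a
    disjoint union of directed cycles.  This follows from the loop lemma: in a
    smooth digraph some power of which is linked, a nontrivial idempotent clone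
    of polymorphisms forces a loop.  Inside an absorption-free subuniverse a
    linked power is complete by the absorption theorem, and otherwise an
    absorbing subuniverse inherits the hypotheses, so induction applies.

    A union [G] of cycles is described by the set of lengths of its closed walks,
    and it is determined in the order by the finite sets [P] of primes for which
    [G] pp-constructs the union of the cycles of length [p] in [P].  These sets
    form finite down-closed families, all of which occur; hence the poset is the
    lattice of such families, ordered by reverse inclusion, with a least element
    added. *)

Set Implicit Arguments.
Unset Strict Implicit.
Unset Printing Implicit Defensive.

(** * Walks *)

(** By the free-structure construction, pp-constructability between finite digraphs is the existence
    of a minion homomorphism, so only polymorphisms matter. Between disjoint unions of cycles such a
    homomorphism comes down to an equivariant map for permutations, whose only obstruction is a
    missing period. The order thereby becomes arithmetic: a union of cycles [G] lies below the prime
    cycles of [n] exactly when some [m > 0] is not the length of a closed walk of [G] while [m * p]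
    is one for every prime [p] dividing [n]. The family of [G] is down-closed because fewer primes
    mean fewer conditions, and finite because all these primes divide an exponent of the
    permutation. Digraphs with trivial polymorphisms lie below all prime cycles; they form the least
    class, which is the infimum whenever a union of families is unbounded. Meets are unions and
    joins are intersections of families, so distributivity is that of propositional logic. *)

Section Walks.
Variable V : Type.
Implicit Types (R : V -> V -> Prop) (A : V -> Prop).

Fixpoint walk R n x y : Prop :=
  if n is n'.+1 then exists2 z, R x z & walk R n' z y else x = y.

Definition restrict R (A : V -> Prop) : V -> V -> Prop :=
  fun x y => [/\ A x, A y & R x y].

Definition common_target R : V -> V -> Prop :=
  fun x y => exists2 z, R x z & R y z.

Definition linked R x y := exists n, walk (common_target R) n x y.

Definition smooth_on R A :=
  forall x, A x -> (exists2 y, A y & R x y) /\ (exists2 y, A y & R y x).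

Lemma walk_cat R m n x y z :
  walk R m x y -> walk R n y z -> walk R (m + n) x z.
Proof.
elim: m x => [|m IHm] x /= => [->//|[u xu uy] yz].
by exists u => //; apply: IHm.
Qed.

Lemma walk_split R m n x z :
  walk R (m + n) x z -> exists2 y, walk R m x y & walk R n y z.
Proof.
elim: m x => [|m IHm] x /=; first by exists x.
by move=> [u xu /IHm[y uy yz]]; exists y => //; exists u.
Qed.

Lemma walk1 R x y : R x y -> walk R 1 x y.
Proof. by exists y. Qed.

Lemma walk_mono R R' n x y :
  (forall u v, R u v -> R' u v) -> walk R n x y -> walk R' n x y.
Proof.
move=> RR'; elim: n x => [//|n IHn] x /= [z xz zy].
by exists z; [apply: RR'|apply: IHn].
Qed.

Lemma walk_rcons R n x y z : walk R n x y -> R y z -> walk R n.+1 x z.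
Proof. by move=> xy yz; rewrite -addn1; apply: walk_cat xy (walk1 yz). Qed.

Lemma walk_last R n x z : walk R n.+1 x z -> exists2 y, walk R n x y & R y z.
Proof. by rewrite -addn1 => /walk_split[y xy [u yu <-]]; exists y. Qed.

Lemma walk_rev R n x y : walk R n x y -> walk (fun u v => R v u) n y x.
Proof.
elim: n x => [|n IHn] x /=; first by move->.
by move=> [z xz /IHn]; move=> yz; apply: walk_rcons yz xz.
Qed.

Lemma walk_sym R n x y :
  (forall u v, R u v -> R v u) -> walk R n x y -> walk R n y x.
Proof. by move=> Rsym /walk_rev; apply: walk_mono => u v /Rsym. Qed.

Lemma walk_pad R m n x y : walk R m x y -> R y y -> m <= n -> walk R n x y.
Proof.
move=> xy yy /subnKC <-; apply: walk_cat xy _.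
by elim: (n - m) => //= k IHk; exists y.
Qed.

Lemma walk_restrict_end R A n x y :
  walk (restrict R A) n x y -> A x -> A y.
Proof. by elim: n x => [|n IHn] x /= => [->//|[z [_ Az _] /IHn]]; auto. Qed.

Lemma walk_restrict_start R A n x y :
  walk (restrict R A) n x y -> A y -> A x.
Proof. by case: n => [|n] /= => [->//|[z [Ax _ _] _]]. Qed.

Lemma smooth_on_walk R A n x : smooth_on R A -> A x ->
  (exists2 y, A y & walk (restrict R A) n x y) /\
  (exists2 y, A y & walk (restrict R A) n y x).
Proof.
move=> sm Ax; split.
  elim: n x Ax => [|n IHn] x Ax; first by exists x.
  have [[y Ay xy] _] := sm x Ax.
  by have [z Az yz] := IHn y Ay; exists z => //=; exists y.
elim: n x Ax => [|n IHn] x Ax; first by exists x.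
have [_ [y Ay yx]] := sm x Ax.
by have [z Az zy] := IHn y Ay; exists z => //; apply: walk_rcons zy _.
Qed.

Lemma walk_restrict_monoS R A A' n x y : (forall u, A u -> A' u) ->
  walk (restrict R A) n x y -> walk (restrict R A') n x y.
Proof. by move=> AA'; apply: walk_mono => u v [Au Av uv]; split; auto. Qed.

Lemma linked_refl R x : linked R x x.
Proof. by exists 0. Qed.

Lemma linked_trans R y x z : linked R x y -> linked R y z -> linked R x z.
Proof. by move=> [m xy] [n yz]; exists (m + n); apply: walk_cat xy yz. Qed.

Lemma common_target_sym R x y : common_target R x y -> common_target R y x.
Proof. by move=> [z xz yz]; exists z. Qed.

Lemma linked_sym R x y : linked R x y -> linked R y x.
Proof.
by move=> [n xy]; exists n; apply: walk_sym xy => u v; apply: common_target_sym.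
Qed.

Lemma linked1 R x y z : R x z -> R y z -> linked R x y.
Proof. by move=> xz yz; exists 1; apply: walk1; exists z. Qed.

End Walks.

(** Brings finitely many walks to one common length, so that an operation can be applied to them
    step by step. *)
Lemma finite_bound (I : finType) (P : I -> Prop) (Q : I -> nat -> Prop) :
  (forall i, P i -> exists n, Q i n) ->
  (forall i m n, P i -> m <= n -> Q i m -> Q i n) ->
  exists n, forall i, P i -> Q i n.
Proof.
move=> PQ Qmono.
have [i|f Qf] := @fin_all_exists I (fun=> nat) (fun i n => P i -> Q i n).
  have [/PQ[n Qn]|nP] := pselect (P i); first by exists n.
  by exists 0 => /nP.
exists (\max_i f i) => i Pi.
by apply: Qmono (Qf i Pi); rewrite ?leq_bigmax.
Qed.

(** * Idempotent clones and absorption *)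

Definition minor (V : Type) (I J : Type) (p : I -> J) (f : (I -> V) -> V) :
  (J -> V) -> V := fun x => f (x \o p).

Definition star (V I J : Type) (f : (I -> V) -> V) (g : (J -> V) -> V) :
  (I * J -> V) -> V := fun x => f (fun i => g (fun j => x (i, j))).

(** Arities are finite types rather than numbers: minors along arbitrary maps and star products on
    [I * J] then need no renumbering of arguments. *)
Definition op_class (V : Type) := forall I : finType, ((I -> V) -> V) -> Prop.

(** A minion homomorphism to the projections, as a relation that selects one
    coordinate of each operation, naturally in the minors. *)
Definition selector (V : Type) (C : op_class V)
    (S : forall I : finType, ((I -> V) -> V) -> I -> Prop) : Prop :=
  (forall (I : finType) (f : (I -> V) -> V), C I f -> exists i, S I f i) /\
  (forall (I : finType) (f : (I -> V) -> V) i j,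
     C I f -> S I f i -> S I f j -> i = j) /\
  (forall (I J : finType) (p : I -> J) (f : (I -> V) -> V) i,
     C I f -> S I f i -> S J (minor p f) (p i)).

Definition trivial_ops (V : Type) (C : op_class V) : Prop :=
  exists S, selector C S.

Record idempotent_clone (V : Type) (C : op_class V) : Prop := IdempotentClone {
  clone_idem : forall (I : finType) (f : (I -> V) -> V) a,
    C I f -> f (fun=> a) = a;
  clone_id : C unit (fun x => x tt);
  clone_minor : forall (I J : finType) (p : I -> J) (f : (I -> V) -> V),
    C I f -> C J (minor p f);
  clone_star : forall (I J : finType) (f : (I -> V) -> V) (g : (J -> V) -> V),
    C I f -> C J g -> C (I * J)%type (star f g) }.

Section Absorption.
Variables (V : finType) (C : op_class V).
Hypotheses (CC : idempotent_clone C) (Cnt : ~ trivial_ops C).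
Implicit Types (A B D : {set V}) (R : V -> V -> Prop).

Definition subuniverse A : Prop :=
  forall (I : finType) (f : (I -> V) -> V) x,
    C f -> (forall i, x i \in A) -> f x \in A.

Definition invariant R : Prop :=
  forall (I : finType) (f : (I -> V) -> V) x y,
    C f -> (forall i, R (x i) (y i)) -> R (f x) (f y).

Definition absorbs_by (I : finType) (t : (I -> V) -> V) B A : Prop :=
  [/\ B != set0, B \subset A, subuniverse B &
      forall i x, x i \in A -> (forall j, j != i -> x j \in B) -> t x \in B].

Definition absorbs B A : Prop :=
  exists (I : finType) (t : (I -> V) -> V), C t /\ absorbs_by t B A.

Definition absorption_free A : Prop := forall B, absorbs B A -> B = A.

Lemma invariant_flip R : invariant R -> invariant (fun x y => R y x).
Proof. by move=> Rinv I f x y Cf xy; apply: Rinv. Qed.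

Lemma invariant_restrict R A : subuniverse A -> invariant R ->
  invariant (restrict R (fun x => x \in A)).
Proof.
move=> Asub Rinv I f x y Cf xy; split.
- by apply: Asub Cf _ => i; case: (xy i).
- by apply: Asub Cf _ => i; case: (xy i).
- by apply: Rinv Cf _ => i; case: (xy i).
Qed.

Lemma invariant_walk R n : invariant R -> invariant (walk R n).
Proof.
move=> Rinv; elim: n => [|n IHn] I f x y Cf xy /=.
  by congr f; apply: funext.
have [z Hz] := @fin_all_exists I (fun=> V) (fun i z => R (x i) z /\ walk R n z (y i))
  (fun i => let: ex_intro2 z a b := xy i in ex_intro _ z (conj a b)).
exists (f z); first by apply: Rinv Cf _ => i; case: (Hz i).
by apply: IHn Cf _ => i; case: (Hz i).
Qed.

Lemma invariant_common_target R : invariant R -> invariant (common_target R).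
Proof.
move=> Rinv I f x y Cf xy.
have [z Hz] := @fin_all_exists I (fun=> V) (fun i z => R (x i) z /\ R (y i) z)
  (fun i => let: ex_intro2 z a b := xy i in ex_intro _ z (conj a b)).
by exists (f z); apply: Rinv Cf _ => i; case: (Hz i).
Qed.

Lemma subuniverse_image R A : invariant R -> subuniverse A ->
  subuniverse [set y | `[< exists2 x, x \in A & R x y >]].
Proof.
move=> Rinv Asub I f y Cf Ry; rewrite inE; apply/asboolP.
have [i|x Hx] := @fin_all_exists I (fun=> V) (fun i x => x \in A /\ R x (y i)).
  by have := Ry i; rewrite inE => /asboolP[x xA xy]; exists x.
exists (f x); first by apply: Asub Cf _ => i; case: (Hx i).
by apply: Rinv Cf _ => i; case: (Hx i).
Qed.

Lemma subuniverse_setI A B : subuniverse A -> subuniverse B ->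
  subuniverse (A :&: B).
Proof.
move=> Asub Bsub I f x Cf xAB; rewrite inE.
by apply/andP; split; [apply: Asub Cf _|apply: Bsub Cf _] => i;
  have := xAB i; rewrite inE => /andP[].
Qed.

Lemma subuniverse_neighbours R A a : invariant R -> subuniverse A ->
  subuniverse [set y in A | `[< R a y >]].
Proof.
move=> Rinv Asub I f y Cf yA; rewrite inE; apply/andP; split.
  by apply: Asub Cf _ => i; have := yA i; rewrite inE => /andP[].
apply/asboolP; rewrite -(clone_idem CC a Cf); apply: Rinv Cf _ => i.
by have := yA i; rewrite inE => /andP[_ /asboolP].
Qed.

(* A set that every operation projects onto along some coordinate either
   absorbs through two such coordinates or makes the clone trivial. *)
Lemma expanding_op_at A B : absorption_free A -> B \proper A -> B != set0 ->
  exists (I : finType) (g : (I -> V) -> V), C g /\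
    forall j, exists x, [/\ forall k, x k \in A, x j \in B & g x \notin B].
Proof.
move=> Afree prBA B0; apply: contrapT => none.
pose S (I : finType) (g : (I -> V) -> V) j :=
  forall x, (forall k, x k \in A) -> x j \in B -> g x \in B.
have SE (I : finType) (g : (I -> V) -> V) : C g -> exists j, S I g j.
  move=> Cg; apply: contrapT => nS; apply: none; exists I, g; split=> // j.
  apply: contrapT => nx; apply: nS; exists j => x xA xB.
  by apply/negPn/negP => gx; apply: nx; exists x.
have sBA := proper_sub prBA.
have Bsub : subuniverse B.
  move=> I f x Cf xB; have [j Sj] := SE I f Cf; apply: Sj => // k.
  exact: (subsetP sBA).
apply: Cnt; exists S; split=> //; split=> [I g i j Cg Si Sj|I J p f i _ Si x xA xB].
  apply/eqP/negPn/negP => nij; have := properP prBA; case=> _ [a aA] /negP; apply.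
  (* Identifying all coordinates other than [i] leaves a binary operation; either argument in [B]
     alone puts the value in [B], because [i] and [j] end up on different sides. So [B] absorbs
     [A]. *)
  rewrite (Afree B) //; exists bool, (minor (fun k => k == i) g).
  split; first exact: clone_minor.
  split=> // b x xb xnb.
  have xA k : x k \in A.
    by have [->//|] := eqVneq k b => /xnb /(subsetP sBA).
  have [Eb|Eb] : b = true \/ b = false by case: b {xb xnb}; auto.
    apply: Sj => [k|/=]; first exact: xA.
    by apply: xnb; rewrite Eb (eq_sym j) (negPf nij).
  apply: Si => [k|/=]; first exact: xA.
  by apply: xnb; rewrite Eb eqxx.
by apply: Si => // k; apply: xA.
Qed.

(** A star product inherits the property from each factor: by idempotence, constant blocks reduce it
    to the outer operation and equal blocks to the inner one. This handles all subsets one after the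
    other. *)
Lemma expanding_op A : absorption_free A ->
  exists (I : finType) (h : (I -> V) -> V), C h /\
    forall B, B \proper A -> B != set0 ->
    forall j, exists x, [/\ forall k, x k \in A, x j \in B & h x \notin B].
Proof.
move=> Afree.
suff [I [h [Ch hP]]] : exists (I : finType) (h : (I -> V) -> V), C h /\
    forall B, B \in enum {set V} -> B \proper A -> B != set0 ->
    forall j, exists x, [/\ forall k, x k \in A, x j \in B & h x \notin B].
  by exists I, h; split=> // B; apply: hP; rewrite mem_enum.
elim: (enum _) => [|B s [I [h [Ch hP]]]].
  by exists unit, (fun x => x tt); split=> //; apply: clone_id CC.
have [[prBA B0]|nB] := pselect (B \proper A /\ B != set0); last first.
  by exists I, h; split=> // B'; rewrite in_cons => /predU1P[->|]; auto => ? ?; case: nB.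
have [J [g [Cg gP]]] := expanding_op_at Afree prBA B0.
exists (J * I)%type, (star g h); split; first exact: clone_star.
move=> B'; rewrite in_cons => /predU1P[->|sB'] prB' B'0 [j i].
  have [x [xA xB gx]] := gP j.
  exists (fun p => x p.1); split=> //; rewrite /star /=.
  suff -> : (fun k => h (fun=> x k)) = x by [].
  by apply: funext => k; rewrite (clone_idem CC).
have [x [xA xB hx]] := hP _ sB' prB' B'0 i.
exists (fun p => x p.2); split=> //; rewrite /star /=.
by rewrite (clone_idem CC) //.
Qed.

(** The set [W] of values with one argument prescribed grows strictly under star products with an
    expanding operation, as long as it is a proper subset of [A]. *)
Lemma transitive_op A : subuniverse A -> absorption_free A ->
  exists (I : finType) (t : (I -> V) -> V), C t /\
    forall i a b, a \in A -> b \in A ->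
      exists x, [/\ forall k, x k \in A, x i = a & t x = b].
Proof.
move=> Asub Afree.
pose W (I : finType) (t : (I -> V) -> V) i a :=
  [set y | `[< exists x, [/\ forall k, x k \in A, x i = a & t x = y] >]].
have Wsub (I : finType) (t : (I -> V) -> V) i a : C t -> W I t i a \subset A.
  move=> Ct; apply/subsetP => y; rewrite inE => /asboolP[x [xA _ <-]].
  exact: Asub.
have [J [h [Ch hP]]] := expanding_op Afree.
(* The first [#|A|] is generalised to a counter [n]: each further product with [h] raises the lower
   bound [minn n #|A|] by one until it reaches [#|A|]. *)
have [I [t [Ct tP]]] : exists (I : finType) (t : (I -> V) -> V), C t /\
    forall i a, a \in A -> minn #|A| #|A| <= #|W I t i a|.
  elim: {1}#|A| => [|n [I [t [Ct tP]]]].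
    exists unit, (fun x => x tt); split; first exact: clone_id CC.
    by move=> i a _; rewrite min0n.
  exists (J * I)%type, (star h t); split; first exact: clone_star.
  move=> [j i] a aA; have WA := Wsub _ t i a Ct.
  have sW : W I t i a \subset W (J * I)%type (star h t) (j, i) a.
    apply/subsetP => y; rewrite !inE => /asboolP[x [xA xa ty]]; apply/asboolP.
    exists (fun p => x p.2); split=> //; rewrite /star /= ty.
    by rewrite (clone_idem CC _ Ch).
  have [EW|nW] := eqVneq (W I t i a) A.
    by apply: leq_trans (subset_leq_card sW); rewrite EW geq_minr.
  have W0 : W I t i a != set0.
    apply/set0Pn; exists a; rewrite inE; apply/asboolP; exists (fun=> a).
    by split=> //; rewrite (clone_idem CC).
  have prW : W I t i a \proper A by rewrite properEneq nW.
  have [x [xA xW hx]] := hP _ prW W0 j.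
  have : W I t i a \proper W (J * I)%type (star h t) (j, i) a.
    apply/properP; split=> //; exists (h x) => //; rewrite inE; apply/asboolP.
    move: (xW); rewrite inE => /asboolP[y [yA yi ty]].
    (* Block [j] evaluates to [x j] through [y], which has the prescribed argument; every other
       block [k] is constant with value [x k]. *)
    exists (fun p => if p.1 == j then y p.2 else x p.1); split=> /=.
    - by move=> [k l] /=; case: ifP.
    - by rewrite eqxx.
    rewrite /star /=; congr h; apply: funext => k.
    by have [->|_] := eqVneq k j; [exact: ty|rewrite (clone_idem CC)].
  move/proper_card; apply: leq_trans; apply: leq_trans (_ : _ <= (minn n #|A|).+1) _.
    by lia.
  by rewrite ltnS tP.
exists I, t; split=> // i a b aA bA; have := tP i a aA; rewrite minnn => cW.
have /eqP EW : W I t i a == A by rewrite eqEcard Wsub.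
have : b \in W I t i a by rewrite EW.
by rewrite inE => /asboolP.
Qed.

(* If [a] has a neighbour [b], pick [y] with [y i = b] and [t y = d]: all other
   arguments lie in the centre, so [t] maps the row of edges to an edge to [d]. *)
Lemma center_absorbs R A D : invariant R -> subuniverse A -> subuniverse D ->
  absorption_free D -> (forall a, a \in A -> exists2 d, d \in D & R a d) ->
  let Z := [set a in A | `[< forall d, d \in D -> R a d >]] in
  Z != set0 -> absorbs Z A.
Proof.
move=> Rinv Asub Dsub Dfree RAD Z Z0.
have [I [t [Ct tP]]] := transitive_op Dsub Dfree.
have ZA a : a \in Z -> a \in A by rewrite inE => /andP[].
have ZR a d : a \in Z -> d \in D -> R a d.
  by rewrite inE => /andP[_ /asboolP]; apply.
exists I, t; split=> //; split=> //.
- by apply/subsetP => a /ZA.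
- move=> J f x Cf xZ; rewrite inE; apply/andP; split.
    by apply: Asub Cf _ => i; apply: ZA.
  apply/asboolP => d dD; rewrite -(clone_idem CC d Cf).
  by apply: Rinv Cf _ => i; apply: ZR.
move=> i x xA xZ; rewrite inE; apply/andP; split.
  by apply: Asub Ct _ => j; have [->//|/xZ /ZA] := eqVneq j i.
apply/asboolP => d dD; have [b bD xb] := RAD _ xA.
have [y [yD yi <-]] := tP i b d bD dD.
apply: Rinv Ct _ => j; have [->|/xZ xjZ] := eqVneq j i; first by rewrite yi.
exact: ZR.
Qed.
End Absorption.

(** * The absorption theorem *)

Section AbsorptionTheorem.
Variables (V : finType) (C : op_class V).
Hypotheses (CC : idempotent_clone C) (Cnt : ~ trivial_ops C).
Implicit Types (A B D S : {set V}) (R E : V -> V -> Prop).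
Local Notation subuniverse := (subuniverse C).
Local Notation invariant := (invariant C).
Local Notation absorbs := (absorbs C).
Local Notation absorption_free := (absorption_free C).
Local Notation absorbs_by := (absorbs_by C).

(** Loops of [common_target R] pad the walks from [a] to the arguments to one length, and
    idempotence fixes their common start. *)
Lemma subuniverse_linked R A a : invariant R -> subuniverse A ->
  (forall x, x \in A -> exists y, R x y) ->
  subuniverse [set x in A | `[< linked R a x >]].
Proof.
move=> Rinv Asub Rl I f x Cf xP.
have xA i : x i \in A by have := xP i; rewrite inE => /andP[].
have ax i : linked R a (x i) by have := xP i; rewrite inE => /andP[_ /asboolP].
rewrite inE; apply/andP; split; first exact: Asub Cf _.
have Tr i : common_target R (x i) (x i) by have [y] := Rl _ (xA i); exists y.
have [n nP] := @finite_bound I (fun=> True)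
  (fun i n => walk (common_target R) n a (x i))
  (fun i _ => ax i) (fun i m n _ lemn w => walk_pad w (Tr i) lemn).
apply/asboolP; exists n; rewrite -(clone_idem CC a Cf).
have Tinv := invariant_common_target Rinv.
by apply: (invariant_walk Tinv Cf) => i; apply: nP.
Qed.

(* For [a] in [A], a minimal subuniverse [D] of the neighbours of [a] that is
   still adjacent to all of [A] is absorption free, and [a] is in the centre of
   [R] between [A] and [D]; so the centre is [A], and then [D] is contained in
   the centre on the other side. *)
Lemma full_of_common_neighbours R A B : invariant R ->
  subuniverse A -> subuniverse B -> absorption_free A -> absorption_free B ->
  (forall b, b \in B -> exists2 a, a \in A & R a b) ->
  (forall a a', a \in A -> a' \in A -> exists b, [/\ b \in B, R a b & R a' b]) ->
  forall a b, a \in A -> b \in B -> R a b.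
Proof.
move=> Rinv Asub Bsub Afree Bfree RBA com a b aA bB.
pose good D := [/\ subuniverse D, D \subset [set y in B | `[< R a y >]] &
  forall a', a' \in A -> exists2 d, d \in D & R a' d].
have [D [[Dsub sD DA] Dmin]] : exists D, good D /\ forall D', good D' -> #|D| <= #|D'|.
  have g0 : good [set y in B | `[< R a y >]].
    split=> // [|a' a'A]; first exact: subuniverse_neighbours.
    have [c [cB ac a'c]] := com a a' aA a'A.
    by exists c => //; rewrite inE cB; apply/asboolP.
  have [D /asboolP gD Dmin] :=
    @arg_minnP _ [set y in B | `[< R a y >]] (fun D => `[< good D >])
      (fun D => #|D|) (asboolT g0).
  by exists D; split=> // D' gD'; apply: Dmin; apply: asboolT.
have DB d : d \in D -> d \in B by move/(subsetP sD); rewrite inE => /andP[].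
have aD d : d \in D -> R a d.
  by move/(subsetP sD); rewrite inE => /andP[_ /asboolP].
(* If [D'] absorbs [D] by [t], then the points of [A] adjacent to [D'] absorb [A] by the same [t],
   hence are all of [A]. So [D'] is good too, and [D] was minimal. *)
have Dfree : absorption_free D.
  move=> D' [I [t [Ct [D'0 sD' D'sub tD']]]].
  pose A' := [set x in A | `[< exists2 d, d \in D' & R x d >]].
  have A'sub : subuniverse A'.
    move=> J f x Cf xA'; rewrite inE; apply/andP; split.
      by apply: Asub Cf _ => i; have := xA' i; rewrite inE => /andP[].
    apply/asboolP; have [i|y Hy] := @fin_all_exists J (fun=> V)
      (fun i d => d \in D' /\ R (x i) d).
      by have := xA' i; rewrite inE => /andP[_ /asboolP[d]]; exists d.
    exists (f y); first by apply: D'sub Cf _ => i; case: (Hy i).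
    by apply: Rinv Cf _ => i; case: (Hy i).
  have EA' : A' = A.
    apply: Afree; exists I, t; split=> //; split=> //.
    - have /set0Pn[d dD'] := D'0.
      have [x xA xd] := RBA d (DB _ (subsetP sD' _ dD')).
      by apply/set0Pn; exists x; rewrite inE xA; apply/asboolP; exists d.
    - by apply/subsetP => x; rewrite inE => /andP[].
    move=> i x xA xA'; rewrite inE; apply/andP; split.
      apply: Asub Ct _ => j; have [->//|/xA'] := eqVneq j i.
      by rewrite inE => /andP[].
    apply/asboolP; have [j|y Hy] := @fin_all_exists I (fun=> V)
      (fun j d => [/\ d \in D, R (x j) d & j != i -> d \in D']).
      have [->|nji] := eqVneq j i; first by have [d] := DA _ xA; exists d.
      have := xA' j nji; rewrite inE => /andP[_ /asboolP[d dD' xd]].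
      by exists d; split=> //; apply: (subsetP sD').
    exists (t y); last by apply: Rinv Ct _ => j; case: (Hy j).
    by apply: (tD' i) => [|j nji]; [case: (Hy i)|case: (Hy j) => _ _; apply].
  apply/eqP; rewrite eqEcard sD'; apply: Dmin; split=> //.
    exact: subset_trans sD' sD.
  by move=> x; rewrite -EA' inE => /andP[_ /asboolP].
have AD x d : x \in A -> d \in D -> R x d.
  pose Z := [set a in A | `[< forall d, d \in D -> R a d >]].
  have EZ : Z = A.
    apply/Afree/(center_absorbs CC Cnt) => //.
    by apply/set0Pn; exists a; rewrite inE aA; apply/asboolP.
  by rewrite -EZ inE => /andP[_ /asboolP]; apply.
pose Z := [set b in B | `[< forall a, a \in A -> R a b >]].
have EZ : Z = B.
  apply/Bfree/(center_absorbs CC Cnt (invariant_flip Rinv)) => //.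
  have [d dD _] := DA a aA.
  by apply/set0Pn; exists d; rewrite inE DB //; apply/asboolP => x xA; apply: AD.
by move: bB; rewrite -EZ inE => /andP[_ /asboolP]; apply.
Qed.

(** Strong induction on the number [n] of [common_target] steps that link all pairs. For [n = 1] any
    two points have a common neighbour. For larger [n], two points meet halfway, so the relation of
    about [n / 2] steps has common neighbours, is full by the preceding lemma, and yields a smaller
    bound. *)
Theorem full_of_linked R A : invariant R -> subuniverse A -> absorption_free A ->
  (forall x y, R x y -> x \in A /\ y \in A) ->
  (forall a, a \in A -> exists b, R a b) ->
  (forall b, b \in A -> exists a, R a b) ->
  (forall a b, a \in A -> b \in A -> linked R a b) ->
  forall a b, a \in A -> b \in A -> R a b.
Proof.
move=> Rinv Asub Afree RA Rl Rr lk.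
pose T := common_target R.
have TA x y : T x y -> y \in A by move=> [z _ /RA[]].
have Tr x : x \in A -> T x x by move=> /Rl[z xz]; exists z.
have walkA n x y : walk T n x y -> x \in A -> y \in A.
  by elim: n x => [|n IHn] x /= => [->|[z /TA zA /IHn yA] _]; auto.
have [n nP] := @finite_bound (V * V)%type (fun p => p.1 \in A /\ p.2 \in A)
  (fun p n => walk T n p.1 p.2) (fun p pA => lk p.1 p.2 pA.1 pA.2)
  (fun p m n pA lemn w => walk_pad w (Tr _ pA.2) lemn).
have {nP} : forall a b, a \in A -> b \in A -> walk T n a b.
  by move=> a b aA bA; apply: (nP (a, b)).
elim/ltn_ind: n => n IHn nP.
have Tinv := invariant_common_target Rinv.
case: n IHn nP => [|[|n]] IHn nP a b aA bA.
- by have [c ac] := Rl a aA; have [_ cA] := RA _ _ ac; rewrite (nP b c).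
- apply: (full_of_common_neighbours Rinv Asub Asub) => // [x xA|x y xA yA].
    by have [y yx] := Rr x xA; exists y => //; case: (RA _ _ yx).
  have [z [u xu zu] zy] := nP x y xA yA; rewrite -{y yA}zy in zu *.
  by exists u; split=> //; case: (RA _ _ xu).
set h := uphalf n.+2; have lth : h < n.+2 by rewrite /h; lia.
apply: (IHn h lth) => //.
apply: (full_of_common_neighbours (invariant_walk Tinv) Asub Asub) => //.
  by move=> x xA; exists x => //; apply: (@walk_pad _ _ 0) => //; apply: Tr.
move=> x y xA yA; have En : n.+2 = h + n.+2./2 by rewrite /h; lia.
have wxy : walk T (h + n.+2./2) x y by rewrite -En; apply: nP.
have [z xz zy] := walk_split wxy.
have zA := walkA _ _ _ xz xA.
exists z; split=> //.
apply: (@walk_pad _ _ n.+2./2); [|exact: Tr|by rewrite /h; lia].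
by apply: walk_sym zy => u v; apply: common_target_sym.
Qed.

(** * The loop lemma *)

Section LoopLemma.
Variable E : V -> V -> Prop.
Hypothesis Einv : invariant E.
Local Notation "E ||_ A" := (restrict E (fun x => x \in A)) (at level 10).

Definition linked_power k A :=
  forall a b, a \in A -> b \in A -> linked (walk (E ||_ A) k) a b.

(* [P] is a class of the linkedness of [E^k], and [B] is the set of ends of
   [k]-walks inside [P].  A vertex reached in at most [k] steps from two vertices
   puts them in the same class, so [k.+1]-walks between points of [B] stay in
   [B]. *)
Lemma smaller_full_power A k : subuniverse A ->
  smooth_on E (fun x => x \in A) -> 0 < k ->
  (forall a b, a \in A -> b \in A -> walk (E ||_ A) k.+1 a b) ->
  ~ linked_power k A ->
  exists B, [/\ B \proper A, B != set0, subuniverse B &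
    forall a b, a \in B -> b \in B -> walk (E ||_ B) k.+1 a b].
Proof.
move=> Asub Esm k0 full nlk.
set EA := E ||_ A in full nlk *.
have EAinv : invariant EA by apply: invariant_restrict.
have [a [b [aA bA nab]]] : exists a b,
    [/\ a \in A, b \in A & ~ linked (walk EA k) a b].
  apply: contrapT => nE; apply: nlk => a b aA bA; apply: contrapT => nab.
  by apply: nE; exists a, b.
pose P := [set x in A | `[< linked (walk EA k) a x >]].
have PA x : x \in P -> x \in A by rewrite inE => /andP[].
have PP x : x \in P -> linked (walk EA k) a x by rewrite inE => /andP[_ /asboolP].
have inP x : x \in A -> linked (walk EA k) a x -> x \in P.
  by move=> xA ax; rewrite inE xA; apply/asboolP.
have Psub : subuniverse P.
  apply: subuniverse_linked => //; first exact: invariant_walk.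
  by move=> x xA; have [[y yA xy] _] := smooth_on_walk k Esm xA; exists y.
have aP : a \in P by apply: inP => //; apply: linked_refl.
have stepP x : x \in A -> exists2 y, y \in P & EA x y.
  move=> xA; have [[y yA ay] _] := smooth_on_walk k Esm aA.
  have [z xz zy] := full x y xA yA; exists z => //.
  by apply: inP; [case: xz|apply: linked1 ay zy].
have walkP n : exists y, walk (E ||_ P) n a y.
  elim: n => [|n [y ay]]; first by exists a.
  have yP := walk_restrict_end ay aP.
  have [z zP [_ _ yz]] := stepP y (PA _ yP).
  by exists z; apply: walk_rcons ay _.
pose B := [set x | `[< exists2 z, z \in P & walk (E ||_ P) k z x >]].
have BP x : x \in B -> x \in P.
  by rewrite inE => /asboolP[z zP zx]; apply: walk_restrict_end zx zP.
have Bsub : subuniverse B.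
  apply: subuniverse_image => //; apply: (invariant_walk).
  exact: invariant_restrict.
exists B; split=> //.
- apply/properP; split; first by apply/subsetP => x /BP/PA.
  by exists b => //; apply/negP => /BP/PP.
- have [y ay] := walkP k; apply/set0Pn; exists y; rewrite inE.
  by apply/asboolP; exists a.
move=> x y xB yB; have := full x y (PA _ (BP _ xB)) (PA _ (BP _ yB)).
have yA := PA _ (BP _ yB).
have back i u : i <= k -> walk EA i u y -> u \in A -> u \in P.
  move=> leik uy uA; move: yB; rewrite inE => /asboolP[z zP].
  rewrite -{1}(subnK leik) => zy; have [w zw wy] := walk_split zy.
  have wP := walk_restrict_end zw zP.
  have [[v vA yv] _] := smooth_on_walk (k - i) Esm yA.
  apply: inP => //; apply: linked_trans (PP _ wP) _.
  apply: (@linked1 _ _ _ _ v).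
    rewrite -(subnKC leik); apply: walk_cat yv.
    by apply: walk_restrict_monoS wy => t /PA.
  by rewrite -(subnKC leik); apply: walk_cat yv.
have : k.+1 <= k.+1 by [].
elim: {1 3 4}k.+1 x xB => [|i IHi] x xB leik //= [u [_ uA xu] uy].
have uP : u \in P by apply: back uy uA.
have uB : u \in B.
  move: (xB); rewrite inE => /asboolP[z zP zx].
  have [z' [_ z'P _] z'u] : walk (E ||_ P) k.+1 z u.
    by apply: walk_rcons zx _; split=> //; apply: BP.
  by rewrite inE; apply/asboolP; exists z'.
by exists u; [split|apply: IHi => //; apply: ltnW].
Qed.

(** * Absorbing subuniverses inherit smoothness and linkedness *)

Section Absorbed.
Variables (I : finType) (t : (I -> V) -> V) (A : {set V}).
Hypotheses (Ct : C t) (Asub : subuniverse A).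
Hypothesis Esm : smooth_on E (fun x => x \in A).
Local Notation absorbs_by := (absorbs_by t).

Definition successors R B := [set y | `[< exists2 x, x \in B & R x y >]].

Lemma absorbs_successors R B : invariant R ->
  (forall y, y \in A -> exists2 x, x \in A & R x y) ->
  (forall x, x \in A -> exists2 y, y \in A & R x y) ->
  absorbs_by B A -> absorbs_by (A :&: successors R B) A.
Proof.
move=> Rinv pre suc [B0 sBA Bsub tB]; split.
- have /set0Pn[x xB] := B0; have [y yA xy] := suc x (subsetP sBA x xB).
  by apply/set0Pn; exists y; rewrite !inE yA; apply/asboolP; exists x.
- exact: subsetIl.
- exact: subuniverse_setI (subuniverse_image _ _).
move=> i y yA yB; rewrite !inE; apply/andP; split.
  by apply: Asub Ct _ => j; have [->//|/yB] := eqVneq j i; rewrite inE => /andP[].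
apply/asboolP; have [j|x Hx] := @fin_all_exists I (fun=> V)
   (fun j u => [/\ u \in A, R u (y j) & j != i -> u \in B]).
  have [->|nji] := eqVneq j i; first by have [u uA uy] := pre _ yA; exists u.
  have := yB j nji; rewrite !inE => /andP[_ /asboolP[u uB uy]].
  by exists u; split=> //; apply: (subsetP sBA).
exists (t x); last by apply: Rinv Ct _ => j; case: (Hx j).
by apply: (tB i) => [|j nji]; [case: (Hx i)|case: (Hx j) => _ _; apply].
Qed.

Lemma absorbs_setI B B' : absorbs_by B A -> absorbs_by B' A -> B :&: B' != set0 ->
  absorbs_by (B :&: B') A.
Proof.
move=> [B0 sB Bsub tB] [B'0 sB' B'sub tB'] BB'0; split=> //.
- exact: subset_trans (subsetIl _ _) sB.
- exact: subuniverse_setI.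
move=> i x xA xB; rewrite inE (tB i x) //= ?(tB' i x) // => j /xB;
  by rewrite inE => /andP[].
Qed.

(** Deleting from [B] the points without a successor in [B] leaves a nonempty absorbing set whose
    points still have predecessors in it. By finiteness this stops, at a smooth set. *)
Lemma smooth_absorbing R B : invariant R ->
  smooth_on R (fun x => x \in A) ->
  absorbs_by B A -> B \proper A ->
  (forall y, y \in B -> exists2 x, x \in B & R x y) ->
  exists S, [/\ absorbs_by S A, S \proper A & smooth_on R (fun x => x \in S)].
Proof.
move=> Rinv Rsm; have [n] := ubnP #|B|; elim: n B => // n IHn B ltBn absB prB pre.
pose B' := B :&: (A :&: successors (fun x y => R y x) B).
have B'E x : x \in B' -> x \in B /\ exists2 y, y \in B & R x y.
  by rewrite !inE => /and3P[xB _ /asboolP].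
have sBA := proper_sub prB.
have inB' x y : x \in B -> y \in B -> R x y -> x \in B'.
  move=> xB yB xy; rewrite !inE xB (subsetP sBA) //; apply/asboolP.
  by exists y.
have absB' : absorbs_by B' A.
  apply: absorbs_setI => //.
    apply: absorbs_successors => //; first exact: invariant_flip.
      by move=> y /Rsm[].
    by move=> y /Rsm[].
  have [/set0Pn[y yB] _ _ _] := absB; have [x xB xy] := pre y yB.
  by apply/set0Pn; exists x; apply: inB' xy.
have [EB|nB] := eqVneq B' B.
  exists B; split=> // x xB; split; last exact: pre.
  by rewrite -EB in xB; case: (B'E x xB) => _ [y]; rewrite EB in xB; exists y.
have sB' : B' \subset B by apply: subsetIl.
apply: (IHn B') => //.
- rewrite -ltnS; apply: leq_trans ltBn; rewrite ltnS; apply: proper_card.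
  by rewrite properEneq nB.
- exact: sub_proper_trans prB.
move=> y yB'; have [yB _] := B'E y yB'; have [x xB xy] := pre y yB.
by exists x => //; apply: inB' xy.
Qed.

(** Otherwise the neighbour sets of proper absorbing sets, in both directions, would remain proper
    and absorbing forever, whereas linkedness reaches all of [A] from one point of [B] in a bounded
    number of steps. *)
Lemma absorbing_expands B k : 0 < k -> linked_power k A ->
  absorbs_by B A -> B \proper A ->
  exists S, [/\ absorbs_by S A, S \proper A &
    (A \subset successors E S) \/ (A \subset successors (fun x y => E y x) S)].
Proof.
move=> k0 lk absB prB; apply: contrapT => none.
pose good S := absorbs_by S A /\ S \proper A.
have good_step R S : (R = E \/ R = (fun x y => E y x)) -> good S ->
    good (A :&: successors R S).
  move=> RE [absS prS]; split.
    by case: RE => ->; apply: absorbs_successors => //;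
       try exact: invariant_flip; move=> y /Esm[].
  rewrite properEneq subsetIl andbT; apply/eqP => /setIidPl sA; apply: none.
  by exists S; split=> //; case: RE sA => -> sA; [left|right].
have walk_good R n S : (R = E \/ R = (fun x y => E y x)) -> good S ->
    exists2 S', good S' & forall x y, x \in S -> walk (R ||_ A) n x y -> y \in S'.
  move=> RE; elim: n S => [|n IHn] S gS.
    by exists S => // x y xS /= <-.
  have [S' gS' S'P] := IHn _ (good_step R S RE gS).
  exists S' => // x y xS [z [_ zA xz] zy]; apply: S'P zy.
  by rewrite !inE zA; apply/asboolP; exists x.
pose T := common_target (walk (E ||_ A) k).
have T_good n S : good S ->
    exists2 S', good S' & forall x y, x \in S -> walk T n x y -> y \in S'.
  elim: n S => [|n IHn] S gS; first by exists S => // x y xS /= <-.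
  have [S1 gS1 S1P] := walk_good E k S (or_introl erefl) gS.
  have [S2 gS2 S2P] := walk_good _ k S1 (or_intror erefl) gS1.
  have [S3 gS3 S3P] := IHn S2 gS2.
  exists S3 => // x y xS [z [u xu zu] zy]; apply: S3P zy.
  apply: S2P (S1P _ _ xS xu) _; move: (walk_rev zu); apply: walk_mono.
  by move=> v w [].
have Tr x : x \in A -> T x x.
  by move=> xA; have [[y yA xy] _] := smooth_on_walk k Esm xA; exists y.
have [/set0Pn[b bB] sBA _ _] := absB.
have [n nP] := @finite_bound V (fun x => x \in A) (fun x n => walk T n b x)
  (fun x xA => lk b x (subsetP sBA b bB) xA)
  (fun x m n xA lemn w => walk_pad w (Tr _ xA) lemn).
have [S [_ prS] SP] := T_good n B (conj absB prB).
case/properP: prS => _ [x xA /negP]; apply; apply: SP bB _; exact: nP.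
Qed.

(** One of the walks may leave [S]: absorption puts the values of [t] at all intermediate points
    back into [S]. *)
Lemma absorbed_walk S k i x y : absorbs_by S A ->
  (forall j, j != i -> walk (E ||_ S) k (x j) (y j)) ->
  (forall j, j != i -> x j \in S) -> x i \in A ->
  walk (E ||_ A) k (x i) (y i) -> walk (E ||_ S) k (t x) (t y).
Proof.
move=> [_ _ _ tS]; elim: k x => [|k IHk] x xy xS xA xyi.
  by congr t; apply: funext => j; have [->//|/xy] := eqVneq j i.
have [j|z Hz] := @fin_all_exists I (fun=> V) (fun j z => [/\ E (x j) z,
    j = i -> z \in A /\ walk (E ||_ A) k z (y j) &
    j != i -> z \in S /\ walk (E ||_ S) k z (y j)]).
  have [->|nji] := eqVneq j i.
    by case: xyi => z [_ zA xz] zy; exists z; split.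
  case: (xy j nji) => z [_ zA xz] zy; exists z; split=> // ji.
  by rewrite ji eqxx in nji.
have [_ /(_ erefl)[zA zyi] _] := Hz i.
have zS j : j != i -> z j \in S by move=> nji; case: (Hz j) => _ _ /(_ nji)[].
exists (t z); last first.
  by apply: IHk => // j nji; case: (Hz j) => _ _ /(_ nji)[].
split; [exact: (tS i)|exact: (tS i)|].
by apply: Einv Ct _ => j; case: (Hz j).
Qed.

(* Replace the arguments of [t] by [b] one at a time. *)
Lemma absorbing_linked S k : linked_power k A -> absorbs_by S A ->
  smooth_on E (fun x => x \in S) -> linked_power k S.
Proof.
move=> lk absS Ssm; have [_ sSA _ _] := absS => a b aS bS.
(* A link of the [i]-th argument inside [A] becomes a link of the values inside [S]. The other
   arguments go along some [k]-walk in [S] and return on the same walk. *)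
have move1 n i x y : (forall j, j != i -> x j = y j /\ x j \in S) ->
    x i \in A ->
    walk (common_target (walk (E ||_ A) k)) n (x i) (y i) ->
    linked (walk (E ||_ S) k) (t x) (t y).
  elim: n x => [|n IHn] x xy xiA /=.
    move=> xyi; have -> : x = y; last exact: linked_refl.
    by apply: funext => j; have [->//|/xy[]] := eqVneq j i.
  move=> [u [v xv uv] uy].
  have uA : u \in A := walk_restrict_start uv (walk_restrict_end xv xiA).
  pose x' j := if j == i then u else x j.
  have x'i : x' i = u by rewrite /x' eqxx.
  have x'j j : j != i -> x' j = x j by rewrite /x' => /negPf ->.
  have [j|w Hw] := @fin_all_exists I (fun=> V) (fun j w =>
      (j = i -> w = v) /\ (j != i -> walk (E ||_ S) k (x j) w)).
    have [->|nji] := eqVneq j i; first by exists v; split.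
    have [_ xjS] := xy j nji.
    have [[w wS xw] _] := smooth_on_walk k Ssm xjS; exists w; split=> // ji.
    by rewrite ji eqxx in nji.
  have [/(_ erefl) wi _] := Hw i.
  apply: (@linked_trans _ _ (t x')).
    apply: (@linked1 _ _ _ _ (t w)).
      apply: (@absorbed_walk S k i) => // [j nji|j nji|]; last by rewrite wi.
        by case: (Hw j) => _; apply.
      by case: (xy j nji).
    apply: (@absorbed_walk S k i) => // [j nji|j nji||].
    - by rewrite x'j //; case: (Hw j) => _; apply.
    - by rewrite x'j //; case: (xy j nji).
    - by rewrite x'i.
    - by rewrite x'i wi.
  apply: IHn; rewrite ?x'i // => j nji; rewrite x'j //; exact: xy.
have moves (s : seq I) :
    linked (walk (E ||_ S) k) (t (fun=> a)) (t (fun j => if j \in s then b else a)).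
  elim: s => [|i s IHs]; first exact: linked_refl.
  apply: linked_trans IHs _; pose x j := if j \in s then b else a.
  have xA : x i \in A by rewrite /x; case: ifP => _; apply: (subsetP sSA).
  have [n nP] := lk (x i) b xA (subsetP sSA _ bS).
  apply: (@move1 n i x) => // [j nji|]; last by rewrite mem_head.
  rewrite in_cons (negPf nji) /= /x; split=> //.
  by case: ifP.
have := moves (enum I); rewrite (clone_idem CC) //.
have -> : (fun j => if j \in enum I then b else a) = fun=> b.
  by apply: funext => j; rewrite mem_enum.
by rewrite (clone_idem CC).
Qed.
End Absorbed.

Theorem loop_lemma A k : subuniverse A -> A != set0 ->
  smooth_on E (fun x => x \in A) -> 0 < k -> linked_power k A ->
  exists2 a, a \in A & E a a.
Proof.
have [n] := ubnP #|A|; elim: n A k => // n IHn A k ltAn Asub A0 Esm k0 lk.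
have IH S l : subuniverse S -> S != set0 -> S \proper A ->
    smooth_on E (fun x => x \in S) -> 0 < l -> linked_power l S ->
    exists2 a, a \in A & E a a.
  move=> Ssub S0 prS Ssm l0 lkS.
  have ltS : #|S| < n by apply: leq_trans (proper_card prS) _; rewrite -ltnS.
  have [a aS aa] := IHn S l ltS Ssub S0 Ssm l0 lkS.
  by exists a => //; apply: (subsetP (proper_sub prS)).
have [Afree|nfree] := pselect (absorption_free A).
  have full l : 0 < l -> linked_power l A ->
      forall a b, a \in A -> b \in A -> walk (E ||_ A) l a b.
    move=> l0 lkl; apply: full_of_linked => //.
    - exact/invariant_walk/invariant_restrict.
    - move=> x y; case: l l0 {lkl} => // l _ xy.
      have xA : x \in A by case: xy => z [].
      by split=> //; apply: walk_restrict_end xy xA.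
    - by move=> a aA; have [[y _ ay] _] := smooth_on_walk l Esm aA; exists y.
    - by move=> a aA; have [_ [y _ ay]] := smooth_on_walk l Esm aA; exists y.
  (* Take the least [l] for which the [l]-th power is full on [A]. If [l = 1], there is a loop.
     Otherwise the power just below is not linked, since it would be full too, and a smaller set
     with a full power exists. *)
  pose P l := `[< 0 < l /\ forall a b, a \in A -> b \in A -> walk (E ||_ A) l a b >].
  have exP : exists l, P l by exists k; apply/asboolP; split=> //; apply: full.
  case: (ex_minnP exP) => -[|l] /asboolP[// _ fl] lmin.
  have [l0|l0] := posnP l.
    have /set0Pn[a aA] := A0; exists a => //.
    by case: (fl a a aA aA) => z [_ _ az]; rewrite l0 /= => za; rewrite za in az.
  have nlk : ~ linked_power l A.
    move=> lkl; suff : l.+1 <= l by rewrite ltnn.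
    by apply: lmin; apply/asboolP; split=> //; apply: full.
  have [B [prB B0 Bsub Bfull]] := smaller_full_power Asub Esm l0 fl nlk.
  apply: (IH B l.+1) => //.
    move=> x xB; split; first by case: (Bfull x x xB xB) => y [_ yB xy] _; exists y.
    by have [y _ [yB _ yx]] := walk_last (Bfull x x xB xB); exists y.
  move=> x y xB yB; apply: (@linked1 _ _ _ _ x); exact: Bfull.
have [B [[I [t [Ct absB]]] nB]] : exists B, absorbs B A /\ B <> A.
  apply: contrapT => none; apply: nfree => B absB; apply: contrapT => nB.
  by apply: none; exists B.
have prB : B \proper A.
  by case: absB => _ sB _ _; rewrite properEneq sB andbT; apply/eqP.
have [S [absS prS SA]] := absorbing_expands Ct Asub Esm k0 lk absB prB.
(* Either all points of [S] have a predecessor in [S], or all have a successor in [S]. The second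
   case prunes along the reversed edges. *)
have [S' [absS' prS' S'sm]] : exists S', [/\ absorbs_by t S' A, S' \proper A &
    smooth_on E (fun x => x \in S')].
  have sSA := proper_sub prS; case: SA => sA.
    apply: (smooth_absorbing Ct Asub Einv Esm absS prS) => y yS.
    by have := subsetP sA y (subsetP sSA y yS); rewrite inE => /asboolP.
  have Esm' : smooth_on (fun x y => E y x) (fun x => x \in A).
    by move=> x /Esm[].
  have [||S' [absS' prS' S'sm]] := smooth_absorbing Ct Asub _ Esm' absS prS.
  - exact: invariant_flip.
  - move=> y yS.
    by have := subsetP sA y (subsetP sSA y yS); rewrite inE => /asboolP.
  by exists S'; split=> // x /S'sm[].
have [S'0 _ S'sub _] := absS'.
exact: IH S'sub S'0 prS' S'sm k0 (absorbing_linked Ct lk absS' S'sm).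
Qed.
End LoopLemma.
End AbsorptionTheorem.

(** * Polymorphism minions *)

Definition poly (G : digraph) : op_class (vertex G) := fun I f =>
  forall x y, (forall i, edge (x i) (y i)) -> edge (f x) (f y).

Definition minion_hom (G H : digraph) : Prop :=
  exists xi : forall I : finType,
      ((I -> vertex G) -> vertex G) -> (I -> vertex H) -> vertex H,
    (forall (I : finType) (f : (I -> vertex G) -> vertex G),
       poly f -> poly (xi I f)) /\
    (forall (I J : finType) (p : I -> J) (f : (I -> vertex G) -> vertex G),
       poly f -> xi J (minor p f) = minor p (xi I f)).

Lemma poly_minor (G : digraph) (I J : finType) (p : I -> J)
    (f : (I -> vertex G) -> vertex G) :
  poly f -> poly (minor p f).
Proof. by move=> pf x y xy; apply: pf => i; apply: xy. Qed.

Lemma minion_hom_refl G : minion_hom G G.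
Proof. by exists (fun _ f => f). Qed.

Lemma minion_hom_trans G H K : minion_hom G H -> minion_hom H K -> minion_hom G K.
Proof.
move=> [xi [xip xim]] [eta [etap etam]]; exists (fun I f => eta I (xi I f)).
split=> [I f /xip/etap//|I J p f pf].
by rewrite xim // etam //; apply: xip.
Qed.

Definition edge_hom (G H : digraph) (h : vertex G -> vertex H) : Prop :=
  forall x y, edge x y -> edge (h x) (h y).

Lemma minion_hom_homs G H (g : vertex G -> vertex H) (h : vertex H -> vertex G) :
  edge_hom g -> edge_hom h -> minion_hom G H.
Proof.
move=> gE hE; exists (fun I f x => g (f (h \o x))); split=> [I f pf x y xy|//].
by apply/gE/pf => i; apply/hE/xy.
Qed.

Lemma Forall_mapP (T : eqType) (U : Type) (f : T -> U) (P : U -> Prop) (s : seq T) :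
  List.Forall P (map f s) <-> (forall x, x \in s -> P (f x)).
Proof.
elim: s => [|x s IHs] /=; first by split=> // _; constructor.
split=> [Ps y|Ps].
  have /List.Forall_cons_iff[Px /IHs Pys] := Ps.
  by rewrite in_cons => /predU1P[->|/Pys].
constructor; first by apply: Ps; rewrite mem_head.
by apply/IHs => y ys; apply: Ps; rewrite in_cons ys orbT.
Qed.

Lemma poly_pp_holds (G : digraph) (I : finType) (f : (I -> vertex G) -> vertex G)
    X (phi : pp_formula digraph_signature X) (v : I -> X -> vertex G) :
  poly f -> (forall i, pp_holds (A := G) (v i) phi) ->
  pp_holds (A := G) (fun x => f (fun i => v i x)) phi.
Proof.
move=> pf /(@fin_all_exists I)[w wP]; exists (fun j => f (fun i => w i j)).
elim: (conjuncts phi) wP => [|a l IHl] wP; first by constructor.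
constructor; last by apply: IHl => i; have /List.Forall_cons_iff[] := wP i.
have {IHl wP} : forall i, atomic_holds (A := G)
    (fun z => match z with inl x => v i x | inr j => w i j end) a.
  by move=> i; have /List.Forall_cons_iff[] := wP i.
pose g i z := match z with inl x => v i x | inr j => w i j end.
case: a => [s args|x y] vP.
  rewrite /= !tnth_map.
  have {}vP i : edge (g i (tnth args ord0)) (g i (tnth args ord_max)).
    by have := vP i; rewrite /= !tnth_map.
  by case: (tnth args ord0) vP => [x|j]; case: (tnth args ord_max) => [y|k] vP;
    apply: pf.
have {}vP : (fun i => g i x) = (fun i => g i y) by apply: funext => i; apply: vP.
rewrite /=; case: x vP => [x|j]; case: y => [y|k] => /= vP; exact: congr1 vP.
Qed.

(** An operation acts coordinatewise on the power, preserves its pp-definable edges, and is carried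
    over to [H] along the two homomorphisms. *)
Lemma minion_hom_of_pp_constructs (G H : digraph) : pp_constructs G H -> minion_hom G H.
Proof.
move=> [K [[n [_ [R [inh [Rpp [h [[h' hK h'K] hR]]]]]]] [[g1 g1P] [g2 g2P]]]].
pose a v : n.-tuple (vertex G) := h' (g1 v).
exists (fun I f y => g2 (h [tuple f (fun i => tnth (a (y i)) j) | j < n])).
split=> // I f pf x y xy.
have [phi phiP] := Rpp tt.
pose T I (F : (I -> vertex G) -> vertex G) (z : I -> vertex H) :=
  [tuple F (fun i => tnth (a (z i)) j) | j < n].
have : R tt [tuple T I f x; T I f y].
  apply/phiP; have := @poly_pp_holds G I f _ phi
    (fun i p => tnth (tnth [tuple a (x i); a (y i)] p.1) p.2) pf.
  have -> : (fun p : 'I_2 * 'I_n => f (fun i =>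
      tnth (tnth [tuple a (x i); a (y i)] p.1) p.2)) =
    (fun p => tnth (tnth [tuple T I f x; T I f y] p.1) p.2).
    apply: funext => -[[[|[|//]] lt2] j] /=; rewrite !(tnth_nth (T I f x)) /=.
      by rewrite tnth_mktuple; congr f; apply: funext => i; rewrite (tnth_nth (a (x i))).
    by rewrite tnth_mktuple; congr f; apply: funext => i; rewrite (tnth_nth (a (x i))).
  apply=> i; apply/phiP/hR.
  have -> : map_tuple h [tuple a (x i); a (y i)] =
      map_tuple g1 [tuple x i; y i] :> 2.-tuple K.
    by apply: val_inj; rewrite /= /a !h'K.
  apply: (g1P tt [tuple x i; y i]); exact: xy.
by move=> /(hR tt) /(g2P tt).
Qed.

(** * The free structure of a polymorphism minion *)

Section FreeStructure.
Variables G H : digraph.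
Local Notation VG := (vertex G).
Local Notation VH := (vertex H).
Let EH := {p : VH * VH | edge p.1 p.2}.
Let src (e : EH) := (val e).1.
Let tgt (e : EH) := (val e).2.
Let d := #|{ffun VH -> VG}|.
Let m := #|{ffun EH -> VG}|.
Let var := ('I_2 * 'I_d + 'I_m)%type.
Let fvar (i : 'I_2) (x : VH -> VG) : var := inl (i, enum_rank (finfun x)).
Let bvar (x : EH -> VG) : var := inr (enum_rank (finfun x)).

(* The graph of the free structure: tables [f] and [g] of operations on [G]
   indexed by [H] are adjacent when they are the source and target minors of one
   polymorphism indexed by the edges of [H]. *)
Definition free_edge : pp_formula digraph_signature ('I_2 * 'I_d) :=
  @PPFormula digraph_signature ('I_2 * 'I_d) m
    ([seq AtomEq _ (fvar ord0 x) (bvar (x \o src)) | x : {ffun VH -> VG}] ++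
     [seq AtomEq _ (fvar ord_max x) (bvar (x \o tgt)) | x : {ffun VH -> VG}] ++
     [seq @AtomRel digraph_signature var tt [tuple bvar u.1; bvar u.2]
        | u : {ffun EH -> VG} * {ffun EH -> VG} <-
            [seq u : {ffun EH -> VG} * {ffun EH -> VG} <-
               enum {: {ffun EH -> VG} * {ffun EH -> VG}}
             | [forall e, edge (u.1 e) (u.2 e)]]]).

Definition op_of_tuple (t : d.-tuple VG) : (VH -> VG) -> VG :=
  fun x => tnth t (enum_rank (finfun x)).

Lemma free_edgeP (t : 2.-tuple (d.-tuple VG)) :
  pp_holds (A := G) (fun p => tnth (tnth t p.1) p.2) free_edge <->
  exists g : (EH -> VG) -> VG, [/\ poly g,
    op_of_tuple (tnth t ord0) = minor src g &
    op_of_tuple (tnth t ord_max) = minor tgt g].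
Proof.
split=> [[w]|[g [pg g0 g1]]].
  move=> /List.Forall_app[/Forall_mapP eq0 /List.Forall_app[/Forall_mapP eq1]].
  move=> /Forall_mapP wE; exists (fun x => w (enum_rank (finfun x))); split.
  - move=> x y xy; have := wE (finfun x, finfun y).
    rewrite mem_filter mem_enum andbT => /(_ _)/=.
    rewrite !(tnth_nth (w (enum_rank (finfun x)))) /=.
    rewrite !ffunK; apply; apply/forallP => e; rewrite !ffunE; exact: xy.
  - apply: funext => x; have := eq0 (finfun x) (mem_enum _ _).
    rewrite /= ffunK /op_of_tuple => ->.
    by rewrite /minor; congr (w (enum_rank _)); apply/ffunP => e; rewrite !ffunE /= ffunE.
  apply: funext => x; have := eq1 (finfun x) (mem_enum _ _).
  rewrite /= ffunK /op_of_tuple => ->.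
  by rewrite /minor; congr (w (enum_rank _)); apply/ffunP => e; rewrite !ffunE /= ffunE.
exists (fun j => g (enum_val j : {ffun EH -> VG})).
apply/List.Forall_app; split; last apply/List.Forall_app; try split.
- apply/Forall_mapP => x _ /=; rewrite enum_rankK.
  have := congr1 (fun F : (VH -> VG) -> VG => F x) g0.
  rewrite /op_of_tuple /minor => ->.
  by congr g; apply: funext => e; rewrite !ffunE.
- apply/Forall_mapP => x _ /=; rewrite enum_rankK.
  have := congr1 (fun F : (VH -> VG) -> VG => F x) g1.
  rewrite /op_of_tuple /minor => ->.
  by congr g; apply: funext => e; rewrite !ffunE.
apply/Forall_mapP => -[u v]; rewrite mem_filter => /andP[/forallP uv _] /=.
rewrite !(tnth_nth (g u)) /= !enum_rankK; apply: pg => e; rewrite !ffunE; exact: uv.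
Qed.

(** A vertex of [H] goes to the projection onto it; a table goes back to the value of its image
    under [xi] at the identity tuple. Compatibility with minors turns the ends of an edge into
    values of one polymorphism, indexed by the edges of [H], at [src] and [tgt]. *)
Lemma pp_constructs_of_minion_hom : minion_hom G H -> pp_constructs G H.
Proof.
move=> [xi [xip xim]].
pose R (s : symbol digraph_signature) (t : (arity s).-tuple (d.-tuple VG)) :=
  pp_holds (A := G) (fun p => tnth (tnth t p.1) p.2) free_edge.
have [g0] := vertex_inhabited G.
have inh : inhabited (d.-tuple VG) by exact: inhabits [tuple g0 | _ < d].
exists (Structure R inh); split.
  exists d; split; first by apply/card_gt0P; exists [ffun=> g0].
  exists R, inh; split; first by move=> s; exists free_edge.
  exists id; split; first by exists id.
  move=> s t; have -> : map_tuple id t = t by apply: val_inj; rewrite /= map_id.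
  by [].
split.
  exists (fun a => [tuple (enum_val j : {ffun VH -> VG}) a | j < d]) => s t ab.
  apply/free_edgeP; exists (fun x => x (exist _ (tnth t ord0, tnth t ord_max) ab)).
  split=> [x y xy||]; first exact: xy.
    by apply: funext => x; rewrite /op_of_tuple tnth_map tnth_mktuple enum_rankK ffunE.
  by apply: funext => x; rewrite /op_of_tuple tnth_map tnth_mktuple enum_rankK ffunE.
exists (fun t => xi VH (op_of_tuple t) id) => s t /free_edgeP[g [pg t0 t1]].
have E0 : xi VH (op_of_tuple (tnth t ord0)) id = xi _ g src by rewrite t0 xim.
have E1 : xi VH (op_of_tuple (tnth t ord_max)) id = xi _ g tgt by rewrite t1 xim.
suff : edge (xi VH (op_of_tuple (tnth t ord0)) id)
            (xi VH (op_of_tuple (tnth t ord_max)) id).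
  by rewrite /= !tnth_map.
rewrite E0 E1; apply: (xip _ _ pg) => e; exact: (valP e).
Qed.
End FreeStructure.

Lemma pp_constructsP (G H : digraph) : pp_constructs G H <-> minion_hom G H.
Proof.
by split; [apply: minion_hom_of_pp_constructs|apply: pp_constructs_of_minion_hom].
Qed.

(** * Equivariant maps *)

Lemma class_representatives (T : Type) (L : T -> T -> Prop) :
  (forall x, L x x) -> (forall x y, L x y -> L y x) ->
  (forall x y z, L x y -> L y z -> L x z) ->
  exists r : T -> T, (forall x, L x (r x)) /\ (forall x y, L x y -> r x = r y).
Proof.
move=> Lr Ls Lt; have [[t0]|nT] := pselect (inhabited T); last first.
  by exists id; split=> x; case: nT.
have [O|f fP] := @choice (T -> Prop) T (fun O t => (exists x, O x) -> O t).
  have [[x Ox]|nO] := pselect (exists x, O x); first by exists x.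
  by exists t0 => /nO.
exists (fun x => f (L x)); split=> [x|x y xy]; first by apply: fP; exists x.
congr f; apply: funext => z; apply: propext; split=> [xz|yz].
  exact: Lt (Ls _ _ xy) xz.
exact: Lt xy yz.
Qed.

Lemma iter_period (T : Type) (r : T -> T) (y : T) d m :
  iter d r y = y -> d %| m -> iter m r y = y.
Proof. by move=> ry /dvdnP[k ->]; rewrite iterM; apply: iter_fix. Qed.

(** In each orbit, a representative of exact period [d] goes to a point [y] with [iter d r y = y],
    and the rest of the orbit follows. The exponent [N] makes all orbits finite cycles even when [T]
    is infinite. *)
Lemma equivariant_map (T Y : Type) (s : T -> T) (r : Y -> Y) (A : T -> Prop) N :
  inhabited Y -> 0 < N -> (forall x, iter N s x = x) ->
  (forall x, A x -> A (s x)) ->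
  (forall x m, 0 < m -> A x -> iter m s x = x -> exists y, iter m r y = y) ->
  exists h : T -> Y, forall x, A x -> h (s x) = r (h x).
Proof.
move=> [y0] N0 sN As per.
have back k x : exists j, iter j s (iter k s x) = x.
  exists (N * k - k); rewrite -iterD subnK ?leq_pmull //.
  by rewrite (iter_period (sN x)) ?dvdn_mulr.
pose L x y := exists k, iter k s x = y.
have [||x y z [k <-] [l <-]|f [fL Lf]] := @class_representatives T L.
- by move=> x; exists 0.
- by move=> x y [k <-]; apply: back.
- by exists (l + k); rewrite iterD.
have Aiter k x : A x -> A (iter k s x) by move=> Ax; elim: k => //= k /As.
have [x|q qP] := @choice T Y (fun x y => A x -> forall k l,
    iter k s x = iter l s x -> iter k r y = iter l r y).
  have [Ax|nA] := pselect (A x); last by exists y0.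
  have exm : exists m, (0 < m) && `[< iter m s x = x >].
    by exists N; rewrite N0; apply/asboolP.
  case: (ex_minnP exm) => d /andP[d0 /asboolP sd] dmin.
  have [y ry] := per x d d0 Ax sd.
  have dvd_d m : iter m s x = x -> d %| m.
    rewrite {1}(divn_eq m d) addnC iterD (iter_period sd (dvdn_mull _ _)) // => sm.
    rewrite /dvdn eqn0Ngt; apply/negP => m0; have := dmin (m %% d).
    by rewrite m0 leqNgt ltn_pmod //= => /(_ (asboolT sm)).
  have main k l : k <= l -> iter k s x = iter l s x -> iter k r y = iter l r y.
    move=> lekl; rewrite -(subnKC lekl) !iterD => skl.
    have [j jk] := back k (iter (l - k) s x); have [i ik] := back k x.
    have : iter (l - k) s x = x.
      have sN' z : iter (N * k - k) s (iter k s z) = z.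
        rewrite -iterD subnK ?leq_pmull //.
        by rewrite (iter_period (sN z)) ?dvdn_mulr.
      by rewrite -[LHS]sN' -skl sN'.
    by move=> /dvd_d /(iter_period ry) ->.
  exists y => _ k l; case: (leqP k l) => [|/ltnW] lekl; first exact: main.
  by move=> /esym /(main _ _ lekl).
have [x|k kP] := @choice T nat (fun x k => iter k s (f x) = x).
  by have [j <-] := fL x; apply: back.
exists (fun x => iter (k x) r (q (f x))) => x Ax.
have -> : f (s x) = f x by apply/esym/Lf; exists 1.
rewrite -iterS; apply: qP; first by have [j <-] := fL x; apply: Aiter.
by rewrite /= kP (@Lf x (s x)) ?kP //; exists 1.
Qed.

Lemma injective_order (X : finType) (p : X -> X) : injective p ->
  exists2 N, 0 < N & forall x, iter N p x = x.
Proof.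
move=> p_inj; exists (#|X|`!); first exact: fact_gt0.
move=> x; apply: iter_period (iter_order p_inj x) _.
by rewrite dvdn_fact // order_gt0 max_card.
Qed.

Lemma iter_inj (T : Type) (f : T -> T) n : injective f -> injective (iter n f).
Proof. by move=> f_inj; elim: n => [|n IHn] x y //= /f_inj/IHn. Qed.

(** * Smooth digraphs with trivial polymorphisms, and unions of cycles *)

Definition trivial_digraph (G : digraph) : Prop := trivial_ops (@poly G).

Lemma trivial_minion_hom G H : trivial_digraph G -> minion_hom G H.
Proof.
move=> [S [S1 [S2 S3]]]; have [h0] := vertex_inhabited H.
have sel (I : finType) (f : (I -> vertex G) -> vertex G) :
    exists xf : (I -> vertex H) -> vertex H,
    poly f -> forall i, S I f i -> forall x, xf x = x i.
  have [pf|npf] := pselect (poly f); last by exists (fun=> h0) => /npf.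
  have [i Si] := S1 I f pf; exists (fun x => x i) => _ j Sj x.
  by rewrite (S2 I f i j).
exists (fun I f => sval (cid (sel I f))); split=> [I f pf x y xy|I J p f pf].
  case: (cid _) => xf /= /(_ pf) xfP; have [i Si] := S1 I f pf.
  by rewrite !(xfP i Si).
case: (cid _) => xm /= xmP; case: (cid _) => xf /= xfP.
have [i Si] := S1 I f pf; apply: funext => x.
have Sm := S3 I J p f i pf Si; have pm := @poly_minor G I J p f pf.
by rewrite (xmP pm _ Sm) /minor (xfP pf _ Si).
Qed.

Lemma trivial_of_minion_hom G H :
  minion_hom G H -> trivial_digraph H -> trivial_digraph G.
Proof.
move=> [xi [xip xim]] [S [S1 [S2 S3]]]; exists (fun I f => S I (xi I f)).
split=> [I f /xip/S1//|]; split=> [I f i j /xip pf|I J p f i pf Si].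
  exact: S2.
by rewrite xim //; apply: S3 => //; apply: xip.
Qed.

(** For injective [p] this is a disjoint union of directed cycles. *)
Definition perm_digraph (X : finType) (p : X -> X) (inh : inhabited X) : digraph :=
  Digraph (fun x y => y == p x) inh.

Definition cyclic_type (G : digraph) : Prop :=
  exists (X : finType) (p : X -> X) (inh : inhabited X), injective p /\
    (exists g : vertex G -> X, edge_hom (H := perm_digraph p inh) g) /\
    (exists h : X -> vertex G, edge_hom (G := perm_digraph p inh) h).

Definition idempotent_poly (G : digraph) : op_class (vertex G) := fun I f =>
  poly f /\ forall a, f (fun=> a) = a.

Lemma idempotent_poly_clone G : idempotent_clone (@idempotent_poly G).
Proof.
split=> [I f a []//||I J p f [pf idf]|I J f g [pf idf] [pg idg]].
- by split=> // x y; apply.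
- by split; [apply: poly_minor|].
split=> [x y xy|a]; last by rewrite /star; under eq_fun do rewrite idg.
by apply: pf => i; apply: pg => j.
Qed.

(** In a core the diagonal of a polymorphism is an automorphism, and minors share it. Composing with
    its inverse makes every polymorphism idempotent, compatibly with minors. *)
Lemma trivial_of_idempotent G :
  (forall h : vertex G -> vertex G, edge_hom h -> injective h) ->
  trivial_ops (@idempotent_poly G) -> trivial_digraph G.
Proof.
move=> core [S [S1 [S2 S3]]].
have invE (I : finType) (f : (I -> vertex G) -> vertex G) : poly f ->
    exists v : vertex G -> vertex G,
      [/\ forall a, v (f (fun=> a)) = a, idempotent_poly (v \o f) &
        forall v', (forall a, v' (f (fun=> a)) = a) -> v' = v].
  move=> pf; pose u a := f (fun=> a).
  have uE : edge_hom u by move=> x y xy; apply: pf.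
  have [[//|N] _ uN] := injective_order (core u uE).
  have vu a : iter N u (u a) = a by rewrite -iterSr uN.
  have vE : edge_hom (iter N u).
    by move=> x y xy; elim: N {uN vu} => //= N; apply: uE.
  exists (iter N u); split=> //; first by split=> // x y xy; apply/vE/pf.
  by move=> v' v'u; apply: funext => a; rewrite -[in LHS](uN a) iterS v'u.
exists (fun I f i => forall v, (forall a, v (f (fun=> a)) = a) -> S I (v \o f) i).
split=> [I f pf|].
  have [v [vf idv uniq_v]] := invE I f pf; have [i Si] := S1 I _ idv.
  by exists i => v' /uniq_v ->.
split=> [I f i j pf Si Sj|I J p f i pf Si v vf].
  have [v [vf idv _]] := invE I f pf.
  by apply: (S2 I (v \o f)); [|apply: Si|apply: Sj].
have [w [wf idw uniq_w]] := invE I f pf.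
have -> : v \o minor p f = minor p (v \o f) by [].
by apply: S3; [rewrite (uniq_w v vf)|apply: Si].
Qed.

Lemma idempotent_power (V : finType) (R : V -> V -> Prop) :
  exists2 N, 0 < N & forall k x y, walk R (k.+1 * N) x y <-> walk R N x y.
Proof.
pose F (k : nat) := [ffun q : V * V => `[< walk R k.+1 q.1 q.2 >]].
pose M := #|{ffun V * V -> bool}|.
have [i [j [ltij Fij]]] : exists i j, i < j /\ F i = F j.
  apply: contrapT => none.
  have /leq_card : injective (fun k : 'I_M.+1 => F k).
    move=> k l Fkl; apply: val_inj; apply: contrapT => /eqP; rewrite neq_ltn.
    by move=> /orP[] lt; apply: none; [exists k, l|exists l, k].
  by rewrite card_ord -/M ltnn.
have per n x y : i < n -> walk R n x y <-> walk R (n + (j - i)) x y.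
  move=> ltin; have eqw z : walk R i.+1 x z <-> walk R j.+1 x z.
    have /ffunP/(_ (x, z)) := Fij; rewrite /F !ffunE /=. exact: asbool_eq_equiv.
  have -> : n + (j - i) = j.+1 + (n - i.+1) by lia.
  rewrite -{1}(subnKC ltin); split=> w; have [z xz zy] := walk_split w;
    by apply: walk_cat zy; apply/eqw.
(* A multiple of the period [j - i] that is also past the preperiod [i]. *)
exists (i.+1 * (j - i)) => [|k x y]; first by rewrite muln_gt0 subn_gt0.
have shift n c : i < n -> walk R (n + c * (j - i)) x y <-> walk R n x y.
  move=> ltin; elim: c => [|c IHc]; first by rewrite addn0.
  by rewrite -IHc mulSn addnCA addnC (per (n + c * (j - i))) // ltn_addr.
rewrite mulSn mulnA shift //; apply: leq_pmulr; by rewrite subn_gt0.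
Qed.

Lemma walk_nat (V : Type) (R : V -> V -> Prop) n x y : walk R n x y ->
  exists u : nat -> V, [/\ u 0 = x, u n = y & forall i, i < n -> R (u i) (u i.+1)].
Proof.
elim: n x => [|n IHn] x /=; first by move->; exists (fun=> y).
move=> [z xz /IHn[u [u0 un uR]]].
exists (fun i => if i is i'.+1 then u i' else x); split=> //.
by case=> [_|i lti] /=; [rewrite u0|apply: uR].
Qed.

Lemma closed_walk_periodic (V : Type) (R : V -> V -> Prop) m x :
  0 < m -> walk R m x x ->
  exists w : nat -> V, (forall i, R (w i) (w i.+1)) /\ (forall i, w (i + m) = w i).
Proof.
move=> m0 xx; have [u [u0 um uR]] := walk_nat xx; exists (fun i => u (i %% m)).
split=> i; last by rewrite modnDr.
have -> : i.+1 %% m = (i %% m).+1 %% m by rewrite -[in LHS]addn1 -modnDml addn1.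
have := ltn_pmod i m0; set j := i %% m => ltj.
have [ltj1|gej1] := ltnP j.+1 m; first by rewrite (modn_small ltj1); apply: uR.
have Ej : j.+1 = m by apply/eqP; rewrite eqn_leq gej1 andbT.
by rewrite Ej modnn u0 -um -Ej; apply: uR.
Qed.

(** The map is equivariant into the infinite walks of [G] under the shift, followed by evaluation at
    0. Closed walks supply the points fixed by powers of the shift. *)
Lemma perm_digraph_hom (X : finType) (p : X -> X) (inh : inhabited X) (G : digraph) :
  injective p -> smooth G ->
  (forall x m, 0 < m -> iter m p x = x ->
     exists a : vertex G, walk (fun u v => edge u v) m a a) ->
  exists h : X -> vertex G, edge_hom (G := perm_digraph p inh) h.
Proof.
move=> p_inj Gs per; have [N N0 pN] := injective_order p_inj.
pose Y := {w : nat -> vertex G | forall i, edge (w i) (w i.+1)}.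
pose sh (w : Y) : Y := exist (fun w : nat -> vertex G => forall i, edge (w i) (w i.+1))
  (fun i => sval w i.+1) (fun i => svalP w i.+1).
have shE m w i : sval (iter m sh w) i = sval w (m + i).
  by elim: m i => //= m IHm i; rewrite IHm addnS.
have Yinh : inhabited Y.
  have [s sP] := @choice _ _ (fun x y : vertex G => edge x y) (fun x => (Gs x).2).
  have [g0] := vertex_inhabited G.
  by split; exists (fun i => iter i s g0) => i; apply: sP.
have [//|x m m0 _ /(per x m m0)[a aa]|h hP] :=
  @equivariant_map X Y p sh (fun=> True) N Yinh N0 pN.
  have [w [wE wm]] := closed_walk_periodic m0 aa.
  exists (exist _ w wE); apply: eq_sig_hprop => [u P Q|]; first exact: Prop_irrelevance.
  by apply: funext => i; rewrite shE /= addnC.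
exists (fun x => sval (h x) 0) => x y /eqP ->; rewrite hP //=.
exact: (svalP (h x) 0).
Qed.

(** * Cores with nontrivial idempotent polymorphisms *)

Section Dichotomy.
Variable G : digraph.
Local Notation V := (vertex G).
Let E (x y : V) : Prop := edge x y.
Hypothesis Gsm : smooth G.

Lemma smooth_walks n x : (exists y, walk E n x y) /\ (exists y, walk E n y x).
Proof.
have sm : smooth_on E (fun=> True).
  by move=> u; have [[v vu] [w uw]] := Gsm u; split; [exists w|exists v].
have [[y _ xy] [z _ zx]] := smooth_on_walk n sm (x := x) I.
by split; [exists y|exists z]; apply: walk_mono (_ : walk _ _ _ _); try eassumption;
  move=> u v [].
Qed.

Variable N : nat.
Hypotheses (N0 : 0 < N)
  (NE : forall k x y, walk E (k.+1 * N) x y <-> walk E N x y).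
Let T := common_target (walk E N).
Let L := linked (walk E N).

Lemma walk_double x y z n m : walk E n x y -> walk E m y z -> n + m = N + N ->
  walk E N x z.
Proof.
move=> xy yz nm; apply/(NE 1); rewrite mul2n -addnn -nm.
exact: walk_cat xy yz.
Qed.

Lemma linked_walkN x y : walk E N x y -> L x y.
Proof.
move=> xy; have [[z yz] _] := smooth_walks N y.
exact: linked1 (walk_double xy yz erefl) yz.
Qed.

(** Makes the map induced by [E] on the classes injective: an edge, a walk of length [N] and a
    further [N - 1] steps have total length [2 * N], which idempotence of the power turns back into
    [N]. *)
Lemma linked_sources x y x' y' : E x x' -> E y y' -> L x' y' -> L x y.
Proof.
have pull u v z : E u v -> walk E N v z -> exists2 d, walk E N.-1 z d & walk E N u d.
  move=> uv vz; have [[d zd] _] := smooth_walks N.-1 z; exists d => //.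
  by apply: (@walk_double u z d N.+1 N.-1) zd _; [exists v|lia].
have pull2 u v u' v' : E u u' -> E v v' -> T u' v' -> T u v.
  move=> uu' vv' [z u'z v'z]; have [d zd ud] := pull _ _ _ uu' u'z; exists d => //.
  by apply: (@walk_double v z d N.+1 N.-1) zd _; [exists v'|lia].
move=> xx' yy' [n]; elim: n x x' xx' => [|n IHn] x x' xx' /=.
  move=> Exy; rewrite -{y'}Exy in yy'; exists 1; apply: walk1.
  apply: (pull2 _ _ x' x') => //; have [[z x'z] _] := smooth_walks N x'.
  by exists z.
move=> [u' xu' uy']; have [_ [u [z uu' Ez]]] := smooth_walks 1 u'.
rewrite /= {z}Ez in uu'.
apply: linked_trans (IHn u u' uu' uy').
by exists 1; apply/walk1/(pull2 _ _ x' u').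
Qed.

(** Makes the map induced by [E] on the classes well defined. *)
Lemma linked_targets x y x' y' : E x x' -> E y y' -> L x y -> L x' y'.
Proof.
have same u v w : E u v -> E u w -> L v w.
  move=> uv uw; have [_ [t tu]] := smooth_walks N.-1 u.
  have tN a : E u a -> walk E N t a.
    by move=> ua; rewrite -(prednK N0); apply: walk_rcons tu ua.
  by apply: linked_trans (linked_sym _) (_ : L t w); apply/linked_walkN/tN.
have push u v : T u v -> exists u' v', [/\ E u u', E v v' & L u' v'].
  move=> [z]; rewrite -(prednK N0) => -[u' uu' u'z] [v' vv' v'z].
  exists u', v'; split=> //; have [[d zd] _] := smooth_walks 1 z.
  by apply: (@linked1 _ _ _ _ d); rewrite -(prednK N0) -addn1;
    [apply: walk_cat u'z zd|apply: walk_cat v'z zd].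
move=> xx' yy' [n]; elim: n x x' xx' => [|n IHn] x x' xx' /=.
  by move=> Exy; apply: same xx' _; rewrite Exy.
move=> [u /push[x1 [u1 [xx1 uu1 xu1]]] uy].
apply: linked_trans (same _ _ _ xx' xx1) _; apply: linked_trans xu1 _.
exact: IHn uu1 uy.
Qed.

(* The walks of length [N] link [E] into classes that [E] permutes; the loop
   lemma for the power of [E] that fixes a class gives a closed walk in it. *)
Lemma cyclic_type_of_core :
  ~ trivial_ops (@idempotent_poly G) -> cyclic_type G.
Proof.
move=> nt.
have [|||r [rL Lr]] := @class_representatives V L.
- exact: linked_refl.
- exact: linked_sym.
- by move=> x y z; apply: linked_trans.
have rr x : r (r x) == r x by apply/eqP/esym/Lr.
have [s sE] := @choice _ _ (fun x y : V => E x y) (fun x => (Gsm x).2).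
pose X := {x : V | r x == x}.
pose cl x : X := exist (fun x => r x == x) (r x) (rr x).
have clP x y : L x y -> cl x = cl y by move=> /Lr Exy; apply: val_inj.
have clL x y : cl x = cl y -> L x y.
  move=> /(congr1 val)/= Exy; apply: linked_trans (rL x) _; rewrite Exy.
  exact/linked_sym/rL.
have clK (x : X) : cl (val x) = x by apply/val_inj/eqP/(valP x).
pose p (x : X) := cl (s (val x)).
have pE x y : E x y -> p (cl x) = cl y.
  move=> xy; apply: clP; apply: linked_targets (sE _) xy _.
  exact/linked_sym/rL.
have pW n x y : walk E n x y -> iter n p (cl x) = cl y.
  elim: n x => [|n IHn] x /=; first by move->.
  by move=> [z /pE xz /IHn <-]; rewrite -xz -iterS iterSr.
have p_inj : injective p.
  move=> x y /clL xy; rewrite -(clK x) -(clK y); apply: clP.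
  exact: linked_sources (sE _) (sE _) xy.
have [g0] := vertex_inhabited G; have inh : inhabited X by exact: inhabits (cl g0).
exists X, p, inh; split=> //; split.
  by exists cl => x y /pE /= ->.
apply: perm_digraph_hom => // x m m0 pmx.
pose R := walk E m; pose B := [set y in [set: V] | `[< L (val x) y >]].
have BE y : (y \in B) = (cl y == x).
  rewrite !inE /=; apply/asboolP/eqP => [xy|yx]; first by rewrite -(clP _ _ xy) clK.
  by apply/linked_sym/clL; rewrite clK.
have CC := idempotent_poly_clone G.
have Einv : invariant (@idempotent_poly G) E by move=> I f u v [pf _] uv; apply: pf.
have RB u v : R u v -> (u \in B) = (v \in B).
  move=> /pW uv; rewrite !BE -(inj_eq (iter_inj (n := m) p_inj)) uv pmx.
  by [].
have [||||||a aB aa] := @loop_lemma V _ CC nt R _ B N.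
- exact: invariant_walk.
- apply: subuniverse_linked => //; first exact: invariant_walk.
  by move=> u _; have [] := smooth_walks N u.
- by apply/set0Pn; exists (val x); rewrite BE clK.
- move=> u uB; have [[v uv] [w wu]] := smooth_walks m u.
  split; first by exists v => //; rewrite -(RB _ _ uv).
  by exists w => //; rewrite (RB _ _ wu).
- exact: N0.
- have blocks n u v : u \in B -> walk E (n * m) u v ->
      walk (restrict R (fun z => z \in B)) n u v.
    elim: n u => [//|n IHn] u uB; rewrite mulSn => w.
    have [z uz zv] := walk_split w; have zB : z \in B by rewrite -(RB _ _ uz).
    by exists z; [split|apply: IHn].
  (* Since walks of length [m * N] join the same points as walks of length [N], the latter can be
     replaced by [N] steps of [R]. *)
  have blockN u v : u \in B -> walk E N u v ->
      walk (restrict R (fun z => z \in B)) N u v.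
    move=> uB /(NE m.-1); rewrite prednK // mulnC; exact: blocks.
  move=> u v uB vB; have /clL : cl u = cl v.
    by move: uB vB; rewrite !BE => /eqP -> /eqP ->.
  move=> [n]; elim: n u uB => [|n IHn] u uB /= => [->|[w [z uz wz] wv]].
    exact: linked_refl.
  have wB : w \in B.
    by rewrite BE -(clP u w) -?BE //; apply: linked1 uz wz.
  apply: linked_trans (IHn w wB wv).
  by apply: (@linked1 _ _ _ _ z); apply: blockN.
by exists a.
Qed.
End Dichotomy.

(** A noninjective endomorphism passes to its image, a smaller smooth digraph that is
    homomorphically equivalent to [G]; the idempotent theory treats the core that is finally
    reached. *)
Theorem trivial_or_cyclic (G : digraph) :
  smooth G -> trivial_digraph G \/ cyclic_type G.
Proof.
have [n] := ubnP #|vertex G|; elim: n G => // n IHn G ltGn Gsm.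
have [core|ncore] :=
  pselect (forall h : vertex G -> vertex G, edge_hom h -> injective h).
  have [t|nt] := pselect (trivial_ops (@idempotent_poly G)).
    by left; apply: trivial_of_idempotent.
  have [N N0 NE] := idempotent_power (fun x y : vertex G => edge x y).
  by right; apply: cyclic_type_of_core NE nt.
have [h [hE nh]] : exists h : vertex G -> vertex G, edge_hom h /\ ~ injective h.
  apply: contrapT => none; apply: ncore => h hE; apply: contrapT => nh.
  by apply: none; exists h.
pose W := {x : vertex G | x \in codom h}.
pose hW x : W := exist (fun x => x \in codom h) (h x) (codom_f h x).
have [g0] := vertex_inhabited G.
pose H := @Digraph W (fun x y => edge (val x) (val y)) (inhabits (hW g0)).
have hWE : edge_hom (H := H) hW by move=> x y /hE.
have vE : edge_hom (G := H) (fun x => val x) by [].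
have Hsm : smooth H.
  move=> [x xh]; have /codomP[y Exy] := xh; have [[u uy] [w yw]] := Gsm y.
  by split; [exists (hW u)|exists (hW w)]; rewrite /= Exy; apply: hE.
have ltHn : #|vertex H| < n.
  apply: leq_trans (_ : #|vertex G| <= n); last by rewrite -ltnS.
  rewrite /= card_sig ltn_neqAle leq_image_card andbT.
  by apply/negP => /image_injP hinj; apply: nh => x y; apply: hinj.
have [tH|[X [p [inh [p_inj [[g gE] [k kE]]]]]]] := IHn H ltHn Hsm.
  by left; apply: trivial_of_minion_hom tH; apply: minion_hom_homs hWE vE.
right; exists X, p, inh; split=> //; split.
  by exists (g \o hW) => x y /hWE/gE.
by exists (fun x => val (k x)) => x y /kE/vE.
Qed.

(** * Minion homomorphisms between unions of cycles *)

(** For a permutation [p] of a finite set and [m > 0]: the length of some cycle divides [m]. *)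
Definition per (X : Type) (p : X -> X) m : Prop := exists x, iter m p x = x.

Lemma per_mull (X : Type) (p : X -> X) m k : per p m -> per p (k * m).
Proof. by move=> [x px]; exists x; rewrite iterM; apply: iter_fix. Qed.

Lemma iter_id_gcd (X : Type) (p : X -> X) (x : X) m N : 0 < m ->
  iter m p x = x -> iter N p x = x -> iter (gcdn m N) p x = x.
Proof.
move=> m0 pm pN; case: (egcdnP N m0) => km kn Ek _.
have : iter (km * m) p x = x by apply: iter_period pm (dvdn_mull _ _).
by rewrite Ek addnC iterD (iter_period pN (dvdn_mull _ _)).
Qed.

Lemma comp_iter (T U : Type) (q : T -> T) n (f : (T -> U) -> U) :
  iter n (fun (f : (T -> U) -> U) x => f (x \o q)) f = fun x => f (x \o iter n q).
Proof.
elim: n => [//|n IHn]; rewrite iterS IHn; apply: funext => x.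
by congr f; apply: funext => y /=; rewrite -iterS iterSr.
Qed.

Section PermDigraphs.
Variables (X Y : finType) (p : X -> X) (q : Y -> Y).
Variables (inhX : inhabited X) (inhY : inhabited Y).
Hypotheses (p_inj : injective p) (q_inj : injective q).
Local Notation GX := (perm_digraph p inhX).
Local Notation GY := (perm_digraph q inhY).

Lemma poly_permP (I : finType) (f : (I -> X) -> X) :
  poly (G := GX) f <-> forall x, f (p \o x) = p (f x).
Proof.
split=> [pf x|pf x y xy]; first by apply/eqP/pf => i /=.
have -> : y = p \o x by apply: funext => i; apply/eqP/(xy i).
by rewrite /= pf.
Qed.

Lemma poly_perm_iter (I : finType) (f : (I -> X) -> X) m x :
  poly (G := GX) f -> f (iter m p \o x) = iter m p (f x).
Proof.
move=> /poly_permP pf; elim: m => [|m IHm]; first by congr f.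
by rewrite iterS -IHm -pf; congr f.
Qed.

(* The polymorphisms of [X] indexed by [Y] are themselves acted on by [q], and a
   minion homomorphism amounts to an equivariant map from them to [Y]. *)
Lemma perm_minion_hom :
  (forall l, 0 < l -> ~ per q l -> exists j m,
     [/\ 0 < j, 0 < m, ~ per p m &
         forall k, 0 < k -> per q (k * (l * j)) -> per p (k * m)]) ->
  minion_hom GX GY.
Proof.
move=> H; have [N N0 qN] := injective_order q_inj.
pose s (f : (Y -> X) -> X) : (Y -> X) -> X := fun x => f (x \o q).
have [||f l l0 pf sf|h hP] :=
  @equivariant_map ((Y -> X) -> X) Y s q (@poly GX Y) N inhY N0.
- by move=> f; rewrite comp_iter; apply: funext => x; congr f; apply: funext => y /=;
    rewrite qN.
- by move=> f pf; apply: (@poly_minor GX Y Y q f).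
- apply: contrapT => nper; have [j [m [j0 m0 nm jm]]] := H l l0 nper.
  have [M M0 qM] := injective_order q_inj.
  (* The tuple [t] intertwines [iter (l * j) q] with [iter m p]. As [f] is invariant under the
     [l]-th power of [q], the value [f t] is fixed by [iter m p], against [nm]. *)
  have [|//|y k k0 _ qk|t tP] :=
    @equivariant_map Y X (iter (l * j) q) (iter m p) (fun=> True) M inhX M0.
  + by move=> y; rewrite -iterM mulnC iterM iter_fix.
  + have [x px] : per p (k * m) by apply: jm => //; exists y; rewrite iterM.
    by exists x; rewrite -iterM.
  apply: nm; exists (f t); rewrite -(poly_perm_iter _ _ pf).
  have -> : iter m p \o t = t \o iter (l * j) q by apply: funext => y /=; rewrite tP.
  have : iter (j * l) s f = f by rewrite iterM iter_fix.
  by rewrite comp_iter mulnC => /(congr1 (fun F : (Y -> X) -> X => F t)).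
exists (fun I f y => h (fun x => f (x \o y))); split=> // I f pf y y' yy'.
have -> : y' = q \o y by apply: funext => i; apply/eqP/(yy' i).
have pm : poly (G := GX) (fun x : Y -> X => f (x \o y)).
  exact: (@poly_minor GX I Y y f).
by rewrite /= -(hP _ pm).
Qed.

(* Otherwise there is a polymorphism [f] of [X], constant on the [q]-orbits of
   the tuples indexed by [Y], and its image fixes a point of [Y]. *)
Lemma perm_minion_hom_obstruction :
  minion_hom GX GY -> (forall y, q y <> y) ->
  exists m, [/\ 0 < m, ~ per p m & forall d, per q d -> per p (m * d)].
Proof.
move=> [xi [xip xim]] fpf; apply: contrapT => none.
have [N N0 pN] := injective_order p_inj; have [M M0 qM] := injective_order q_inj.
pose O (t u : Y -> X) := exists k, u = t \o iter k q.
pose s (P : (Y -> X) -> Prop) : (Y -> X) -> Prop :=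
  fun u => exists2 t, P t & u = p \o t.
have sE m P u : iter m s P u <-> exists2 t, P t & u = iter m p \o t.
  elim: m u => [|m IHm] u /=; first by split=> [Pu|[t Pt ->]]; [exists u|].
  split=> [[t /IHm[w Pw ->] ->]|[t Pt ->]]; first by exists w.
  by exists (iter m p \o t) => //; apply/IHm; exists t.
have sO t : s (O t) = O (p \o t).
  apply: funext => u; apply: propext; split=> [[w [k ->] ->]|[k ->]].
    by exists k.
  by exists (t \o iter k q) => //; exists k.
have Oq t : O (t \o q) = O t.
  apply: funext => u; apply: propext; split=> [[k ->]|[k ->]].
    by exists k.+1; apply: funext => y.
  exists (k + M.-1); apply: funext => y /=.
  by rewrite -iterS -addnS prednK // iterD qM.
have [|P [t ->]|P m m0 [t ->] sm|h hP] := @equivariant_map ((Y -> X) -> Prop) X s p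
    (fun P => exists t, P = O t) N inhX N0.
- move=> P; apply: funext => u; apply: propext.
  have Ep (w : Y -> X) : iter N p \o w = w by apply: funext => y /=; apply: pN.
  by rewrite sE; split=> [[w Pw ->]|Pu]; [rewrite Ep|exists u].
- by exists (p \o t).
(* If [iter m p] fixes the orbit of [t], then [iter m p \o t = t \o iter k q] for some [k], so a [y]
   with [iter d q y = y] makes [t y] a fixed point of [iter (m * d) p]. *)
- suff [x px] : per p m by exists x.
  have [k Ek] : O t (iter m p \o t).
    by rewrite -sm; apply/sE; exists t => //; exists 0.
  have tk y : iter m p (t y) = t (iter k q y) by apply: (congr1 (@^~ y) Ek).
  apply: contrapT => nm; apply: none; exists m; split=> // d [y qd].
  exists (t y); have td e z : iter e (iter m p) (t z) = t (iter e (iter k q) z).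
    by elim: e => //= e ->.
  by rewrite mulnC iterM td -iterM mulnC iterM iter_fix.
pose f t := h (O t).
have pf : poly (G := GX) f.
  by apply/poly_permP => x; rewrite /f -hP; [rewrite sO|exists x].
have fq : minor q f = f by apply: funext => t; rewrite /minor /f Oq.
have pF := xip Y f pf.
have qF : xi Y f (q \o id) = q (xi Y f id).
  by apply/eqP/(pF id (q \o id)) => y /=.
apply: (fpf (xi Y f id)); rewrite -qF.
by have := congr1 (fun F : (Y -> Y) -> Y => F id) (xim Y Y q f pf); rewrite fq.
Qed.
End PermDigraphs.

Definition period (G : digraph) m : Prop :=
  exists a : vertex G, walk (fun x y => edge x y) m a a.

Lemma period_hom (G H : digraph) (h : vertex G -> vertex H) m :
  edge_hom h -> period G m -> period H m.
Proof.
move=> hE [a aa]; exists (h a).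
suff hw n x y : walk (fun x y => edge x y) n x y ->
    walk (fun x y => edge x y) n (h x) (h y) by apply: hw.
elim: n x => [|n IHn] x /=; first by move->.
by move=> [z /hE xz /IHn zy]; exists (h z).
Qed.

Lemma period_perm (X : finType) (p : X -> X) (inh : inhabited X) m :
  period (perm_digraph p inh) m <-> per p m.
Proof.
have E n x y : walk (fun x y => edge (d := perm_digraph p inh) x y) n x y <->
    iter n p x = y.
  elim: n x => [|n IHn] x //; rewrite iterSr /=.
  by split=> [[z /eqP -> /IHn]//|/IHn xy]; exists (p x).
by split=> -[x /E px]; exists x.
Qed.

Lemma cyclic_typeE G : cyclic_type G ->
  exists (X : finType) (p : X -> X) (inh : inhabited X),
    [/\ injective p, forall m, period G m <-> per p m,
        minion_hom G (perm_digraph p inh) & minion_hom (perm_digraph p inh) G].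
Proof.
move=> [X [p [inh [p_inj [[g gE] [h hE]]]]]]; exists X, p, inh; split=> //.
- move=> m; rewrite -(period_perm p inh).
  by split; [apply: period_hom gE|apply: period_hom hE].
- exact: minion_hom_homs gE hE.
- exact: minion_hom_homs hE gE.
Qed.

Lemma cyclic_minion_hom G H : cyclic_type G -> cyclic_type H ->
  (forall l, 0 < l -> ~ period H l -> exists j m,
     [/\ 0 < j, 0 < m, ~ period G m &
         forall k, 0 < k -> period H (k * (l * j)) -> period G (k * m)]) ->
  minion_hom G H.
Proof.
move=> /cyclic_typeE[X [p [iX [p_inj pP GX XG]]]].
move=> /cyclic_typeE[Y [q [iY [q_inj qP HY YH]]]] cond.
apply: minion_hom_trans GX (minion_hom_trans _ YH).
apply: perm_minion_hom => // l l0; rewrite -qP => /(cond l l0)[j [m [j0 m0 nm jm]]].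
exists j, m; split=> //; first by rewrite -pP.
by move=> k k0; rewrite -qP -pP; apply: jm.
Qed.

Lemma cyclic_minion_hom_obstruction G H : cyclic_type G -> cyclic_type H ->
  minion_hom G H -> ~ period H 1 ->
  exists m, [/\ 0 < m, ~ period G m & forall d, period H d -> period G (m * d)].
Proof.
move=> /cyclic_typeE[X [p [iX [p_inj pP GX XG]]]].
move=> /cyclic_typeE[Y [q [iY [q_inj qP HY YH]]]] GH n1.
have XY := minion_hom_trans XG (minion_hom_trans GH HY).
have [|m [m0 nm md]] := perm_minion_hom_obstruction p_inj q_inj XY.
  by move=> y qy; apply: n1; apply/qP; exists y.
exists m; split=> //; first by rewrite pP.
by move=> d; rewrite qP pP; apply: md.
Qed.

(** The positive periods are therefore determined by the divisors of one number [N]. *)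
Lemma cyclic_period G : cyclic_type G ->
  exists2 N, 0 < N & period G N /\
    forall k, 0 < k -> period G k -> period G (gcdn k N).
Proof.
move=> /cyclic_typeE[X [p [[x0] [p_inj pP _ _]]]].
have [N N0 pN] := injective_order p_inj; exists N => //; split.
  by apply/pP; exists x0.
move=> k k0 /pP[x px]; apply/pP; exists x; exact: iter_id_gcd.
Qed.

Lemma period_mull G m k : cyclic_type G -> period G m -> period G (k * m).
Proof.
move=> /cyclic_typeE[X [p [_ [_ pP _ _]]]]; rewrite !pP; exact: per_mull.
Qed.

Lemma period_dvd G m k : cyclic_type G -> m %| k -> period G m -> period G k.
Proof. by move=> Gc /dvdnP[c ->]; apply: period_mull. Qed.

Lemma smooth_perm_digraph (X : finType) (p : X -> X) (inh : inhabited X) :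
  injective p -> smooth (perm_digraph p inh).
Proof.
by move=> p_inj x; split; [exists (invF p_inj x); rewrite /= f_invF|exists (p x) => /=].
Qed.

Lemma iter_ordS n m (i : 'I_n) : val (iter m (@ordS n) i) = (i + m) %% n.
Proof.
elim: m => [|m IHm]; first by rewrite addn0 modn_small.
by rewrite iterS /= IHm -addn1 modnDml addn1 addnS.
Qed.

Lemma cycle_union (s : seq nat) : (exists2 d, d \in s & 0 < d) ->
  exists2 G : smooth_digraph, cyclic_type G &
    forall m, period G m <-> exists d, [/\ d \in s, 0 < d & d %| m].
Proof.
move=> [d0 sd0 d0_gt0]; pose len (i : 'I_(size s)) := nth 0 s i.
pose X := {i : 'I_(size s) & 'I_(len i)}.
pose p (x : X) : X := Tagged (fun i => 'I_(len i)) (ordS (tagged x)).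
have p_inj : injective p.
  move=> [i a] [j b] /= /[dup] /(congr1 tag) /= Eij; rewrite -{j}Eij in b *.
  by move=> /eqP; rewrite eq_Tagged /= => /eqP/ordS_inj ->.
have pE m i (a : 'I_(len i)) : iter m p (Tagged (fun i => 'I_(len i)) a) =
    Tagged (fun i => 'I_(len i)) (iter m (@ordS _) a).
  by elim: m => //= m ->.
have lti d : d \in s -> index d s < size s by rewrite index_mem.
have inh : inhabited X.
  have l0 : 0 < len (Ordinal (lti d0 sd0)) by rewrite /len /= nth_index.
  by split; apply: (Tagged (fun i => 'I_(len i)) (Ordinal l0)).
exists (SmoothDigraph (@smooth_perm_digraph X p inh p_inj)).
  by exists X, p, inh; split=> //; split; exists id.
move=> m; rewrite period_perm; split=> [[[i a] /eqP]|[d [ds d0' dm]]].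
  rewrite pE eq_Tagged /= => /eqP/(congr1 val); rewrite iter_ordS => Ea.
  have l0 : 0 < len i by apply: leq_ltn_trans (ltn_ord a).
  exists (len i); split=> //; first exact: mem_nth.
  have : a + m == a + 0 %[mod len i] by rewrite addn0 Ea modn_small.
  by rewrite eqn_modDl mod0n.
have Ed : len (Ordinal (lti d ds)) = d by rewrite /len /= nth_index.
have l0 : 0 < len (Ordinal (lti d ds)) by rewrite Ed.
exists (Tagged (fun i => 'I_(len i)) (Ordinal l0)); rewrite pE; congr existT.
by apply: val_inj; rewrite iter_ordS /= add0n Ed; apply/eqP.
Qed.

(** The cycle lengths are the divisors of [N] in [P]; closure under gcd with [N] brings every [k] in
    [P] down to one of them. *)
Lemma realize_periods (P : nat -> Prop) N : 0 < N -> P N ->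
  (forall k, 0 < k -> P k -> P (gcdn k N)) -> (forall k l, P l -> P (k * l)) ->
  exists2 G : smooth_digraph, cyclic_type G &
    forall k, 0 < k -> period G k <-> P k.
Proof.
move=> N0 PN Pgcd Pmul.
have [|G Gc GP] := @cycle_union [seq d <- divisors N | `[< P d >]].
  exists N => //; rewrite mem_filter -dvdn_divisors // dvdnn andbT.
  exact: asboolT.
exists G => // k k0; rewrite GP; split=> [[d [sd d0 /dvdnP[c ->]]]|Pk].
  by move: sd; rewrite mem_filter => /andP[/asboolP/Pmul].
exists (gcdn k N); rewrite dvdn_gcdl gcdn_gt0 k0; split=> //.
rewrite mem_filter -dvdn_divisors // dvdn_gcdr andbT; apply: asboolT.
exact: Pgcd.
Qed.

(** * Separation by unions of prime cycles *)

Lemma gcdn_gt1P k n : 0 < n ->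
  reflect (exists p, [/\ prime p, p %| k & p %| n]) (1 < gcdn k n).
Proof.
move=> n0; apply: (iffP idP) => [lt1|[p [pp pk pn]]].
  exists (pdiv (gcdn k n)); rewrite pdiv_prime //.
  by rewrite !(dvdn_trans (pdiv_dvd _)) ?dvdn_gcdl ?dvdn_gcdr.
apply: leq_trans (prime_gt1 pp) (dvdn_leq _ _); last by rewrite dvdn_gcd pk.
by rewrite gcdn_gt0 n0 orbT.
Qed.

(* Up to homomorphic equivalence, the union of the cycles of length [p] for the
   prime divisors [p] of [n]. *)
Lemma prime_cycles_exist n : exists S : smooth_digraph, 1 < n ->
  cyclic_type S /\ forall k, 0 < k -> period S k <-> 1 < gcdn k n.
Proof.
have [n1|] := ltnP 1 n; last first.
  have [|S _ _] := @cycle_union [:: 1]; first by exists 1.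
  by exists S.
have n0 := ltnW n1.
have [|k k0|k l|S Sc SP] := @realize_periods (fun k => 1 < gcdn k n) n n0.
- by rewrite gcdnn.
- by rewrite -gcdnA gcdnn.
- move=> /(gcdn_gt1P _ n0)[p [pp pl pn]]; apply/(gcdn_gt1P _ n0).
  by exists p; split=> //; apply: dvdn_mull.
by exists S.
Qed.

Definition prime_cycles n : smooth_digraph := sval (cid (prime_cycles_exist n)).

Lemma prime_cycles_cyclic n : 1 < n -> cyclic_type (prime_cycles n).
Proof. by move=> /(svalP (cid (prime_cycles_exist n)))[]. Qed.

Lemma period_prime_cycles n k : 1 < n -> 0 < k ->
  period (prime_cycles n) k <-> 1 < gcdn k n.
Proof. by move=> /(svalP (cid (prime_cycles_exist n)))[_]; apply. Qed.

(** A number [n > 1] stands for the set of its prime divisors. *)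
Definition below (G : digraph) n : Prop := minion_hom G (prime_cycles n).

(** One direction tests the general obstruction at primes. Conversely the same [m], with [j = 1],
    serves every [l]: if [l] is coprime to [n] and [k * l] is not, then some prime divisor of [n]
    divides [k]. *)
Lemma cyclic_belowP G n : cyclic_type G -> 1 < n ->
  below G n <-> exists m, [/\ 0 < m, ~ period G m &
                              forall p, prime p -> p %| n -> period G (m * p)].
Proof.
move=> Gc n1; have n0 := ltnW n1; have Sc := prime_cycles_cyclic n1.
split=> [GS|[m [m0 nm mp]]].
  have [|m [m0 nm md]] := cyclic_minion_hom_obstruction Gc Sc GS.
    by rewrite period_prime_cycles // gcd1n.
  exists m; split=> // p pp pn; apply/md/period_prime_cycles => //.
    exact: prime_gt0.
  by apply/gcdn_gt1P => //; exists p.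
apply: cyclic_minion_hom => // l l0 nl; exists 1, m; split=> // k k0.
have kl0 : 0 < k * (l * 1) by rewrite muln1 muln_gt0 k0.
rewrite period_prime_cycles // muln1 => /(gcdn_gt1P _ n0)[p [pp pkl pn]].
have pk : p %| k.
  move: pkl; rewrite Euclid_dvdM // => /orP[//|pl]; case: nl.
  by apply/period_prime_cycles/gcdn_gt1P => //; exists p.
apply: period_dvd (mp p pp pn) => //.
by rewrite mulnC; apply: dvdn_mul.
Qed.

(* For [l] with [period H l] false, a multiple [l * j] with the same property and
   with maximal gcd with the exponent [N] satisfies: [H] lies below the prime
   cycles of [n = N / gcd (l * j) N]. *)
Lemma cyclic_separation G H : cyclic_type G -> cyclic_type H ->
  (forall n, 1 < n -> below H n -> below G n) -> minion_hom G H.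
Proof.
move=> Gc Hc HG; apply: cyclic_minion_hom => // l l0 nl.
have [N N0 [HN Hgcd]] := cyclic_period Hc.
pose Q g := `[< exists j, [/\ 0 < j, ~ period H (l * j) & g = gcdn (l * j) N] >].
have exQ : exists g, Q g.
  by exists (gcdn (l * 1) N); apply: asboolT; exists 1; rewrite muln1.
have ubQ g : Q g -> g <= N.
  by move=> /asboolP[j [j0 _ ->]]; rewrite dvdn_leq // dvdn_gcdr.
case: (ex_maxnP exQ ubQ) => d /asboolP[j [j0 nj Ed]] dmax.
have lj0 : 0 < l * j by rewrite muln_gt0 l0.
have dN : d %| N by rewrite Ed dvdn_gcdr.
have d0 : 0 < d by rewrite Ed gcdn_gt0 lj0.
pose n := N %/ d; have Nn : N = n * d by rewrite /n divnK.
have n0 : 0 < n by rewrite divn_gt0 // dvdn_leq.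
have n1 : 1 < n.
  rewrite ltn_neqAle n0 andbT; apply/eqP => n1; apply: nj.
  apply: period_dvd HN => //; rewrite Nn -n1 mul1n Ed; exact: dvdn_gcdl.
have Hn : below H n.
  apply/cyclic_belowP => //; exists (l * j); split=> // p pp pn.
  apply: contrapT => nljp; have : gcdn (l * (j * p)) N <= d.
    apply: dmax; apply: asboolT; exists (j * p); split=> //.
      by rewrite muln_gt0 j0 prime_gt0.
    by rewrite mulnA.
  rewrite leqNgt => /negP; apply; apply: leq_trans (_ : d * p <= _).
    by rewrite ltn_Pmulr // prime_gt1.
  apply: dvdn_leq; first by rewrite gcdn_gt0 N0 orbT.
  rewrite dvdn_gcd mulnA; apply/andP; split.
    by apply: dvdn_mul => //; rewrite Ed dvdn_gcdl.
  by rewrite Nn mulnC; apply: dvdn_mul.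
have /cyclic_belowP[//|//|m [m0 nm mp]] := HG n n1 Hn.
exists j, m; split=> // k k0 Hk.
have [/(gcdn_gt1P _ n0)[p [pp pk pn]]|] := ltnP 1 (gcdn k n).
  apply: period_dvd (mp p pp pn) => //; rewrite mulnC; exact: dvdn_mul.
(* If [k] is coprime to [n], then [gcdn (k * (l * j)) N] equals [d], a divisor of [l * j], and
   [l * j] would be a period. *)
move=> gle1; exfalso; apply: nj.
have cop : coprime n k.
  by rewrite /coprime gcdnC eqn_leq gle1 gcdn_gt0 n0 orbT.
have klj0 : 0 < k * (l * j) by rewrite muln_gt0 k0.
apply: period_dvd (Hgcd _ klj0 Hk) => //.
have /dvdnP[e Ee] : d %| l * j by rewrite Ed dvdn_gcdl.
have cne : coprime n e.
  have : gcdn (e * d) (n * d) = d by rewrite -Ee -Nn -Ed.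
  rewrite -muln_gcdl => /eqP; rewrite -[X in _ == X]mul1n eqn_pmul2r //.
  by rewrite /coprime gcdnC.
rewrite Nn Ee mulnA -muln_gcdl dvdn_pmul2r //.
rewrite (_ : gcdn (k * e) n = 1) ?dvd1n //; apply/eqP.
by rewrite gcdnC; change (coprime n (k * e)); rewrite coprimeMr cop.
Qed.

(** If [p] does not divide the exponent [N], then [gcdn (m * p) N] divides [m], so [m * p] is a
    period only if [m] is. *)
Lemma cyclic_below_bounded G : cyclic_type G -> exists2 N, 0 < N &
  forall n, 1 < n -> below G n -> forall p, prime p -> p %| n -> p %| N.
Proof.
move=> Gc; have [N N0 [GN Ggcd]] := cyclic_period Gc; exists N => // n n1.
move=> /(cyclic_belowP Gc n1)[m [m0 nm mp]] p pp pn; apply: contrapT => /negP npN.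
apply: nm; have mp0 : 0 < m * p by rewrite muln_gt0 m0 prime_gt0.
apply: period_dvd (Ggcd _ mp0 (mp p pp pn)) => //.
have copNp : coprime N p by rewrite coprime_sym prime_coprime.
by rewrite gcdnC Gauss_gcdl // dvdn_gcdr.
Qed.

Lemma below_down G n n' : smooth G -> 1 < n -> 1 < n' ->
  (forall p, prime p -> p %| n' -> p %| n) -> below G n -> below G n'.
Proof.
move=> Gsm n1 n'1 n'n; have [t|Gc] := trivial_or_cyclic Gsm.
  by move=> _; apply: trivial_minion_hom.
move=> /(cyclic_belowP Gc n1)[m [m0 nm mp]]; apply/cyclic_belowP => //.
by exists m; split=> // p pp pn'; apply: mp => //; apply: n'n.
Qed.

Theorem separation G H : smooth G -> smooth H ->
  (forall n, 1 < n -> below H n -> below G n) -> minion_hom G H.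
Proof.
move=> Gsm Hsm HG; have [t|Gc] := trivial_or_cyclic Gsm.
  exact: trivial_minion_hom.
have [t|Hc] := trivial_or_cyclic Hsm; last exact: cyclic_separation.
(* A trivial [H] lies below every prime cycle, but a cyclic [G] does not lie below one whose prime
   exceeds [N]. *)
have [N N0 Nb] := cyclic_below_bounded Gc.
have [p ltNp pp] := prime_above N; have p1 := prime_gt1 pp.
have Gp : below G p by apply: HG => //; apply: trivial_minion_hom.
have := Nb p p1 Gp p pp (dvdnn p); move/(dvdn_leq N0).
by rewrite leqNgt ltNp.
Qed.

Lemma squarefree_radical N : 0 < N -> exists M, [/\ 0 < M,
  forall p, prime p -> p %| N -> p %| M & forall p, prime p -> ~~ (p * p %| M)].
Proof.
move=> N0; pose Q M := (0 < M) && all (dvdn^~ M) (primes N).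
have exQ : exists M, Q M.
  by exists N; rewrite /Q N0; apply/allP => p; rewrite mem_primes => /and3P[].
case: (ex_minnP exQ) => M /andP[M0 /allP MP] Mmin; exists M; split=> // p pp.
  by move=> pN; apply: MP; rewrite mem_primes pp N0.
apply/negP => ppM; have /dvdnP[c Ec] : p %| M by apply: dvdn_trans ppM; apply: dvdn_mulr.
have c0 : 0 < c by move: M0; rewrite Ec muln_gt0 => /andP[].
suff /Mmin : Q c by rewrite Ec leqNgt ltn_Pmulr // prime_gt1.
rewrite /Q c0; apply/allP => r rN; have := MP r rN; rewrite Ec.
have pr : prime r by move: rN; rewrite mem_primes => /and3P[].
rewrite Euclid_dvdM // => /orP[//|]; rewrite dvdn_prime2 // => /eqP ->.
by move: ppM; rewrite Ec dvdn_pmul2r // prime_gt0.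
Qed.

(* The required periods are the [k] not coprime to any maximal divisor [n] of the
   square-free [M] in [P].  For such [n], [M / n] is not a period, but
   [M / n * p] is one for each prime [p] dividing [n], by maximality. *)
Theorem realize_below (P : nat -> Prop) N : 0 < N ->
  (forall n, P n -> 1 < n /\ forall p, prime p -> p %| n -> p %| N) ->
  (forall n n', P n -> 1 < n' -> (forall p, prime p -> p %| n' -> p %| n) -> P n') ->
  exists G : smooth_digraph, forall n, 1 < n -> below G n <-> P n.
Proof.
move=> N0 Pb Pdown; have [M [M0 NM sqM]] := squarefree_radical N0.
pose mx n := [/\ n %| M, P n & forall n', n' %| M -> P n' -> n %| n' -> n' = n].
have mx0 n : mx n -> 0 < n by move=> [_ /Pb[/ltnW]].
have extend n : P n -> exists2 n1, mx n1 & forall p, prime p -> p %| n -> p %| n1.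
  move=> Pn; have [n1 nN] := Pb n Pn.
  have gP p : prime p -> p %| n -> p %| gcdn n M.
    by move=> pp pn; rewrite dvdn_gcd pn; apply: NM => //; apply: nN.
  have g1 : 1 < gcdn n M.
    apply/(gcdn_gt1P _ M0); exists (pdiv n); rewrite pdiv_prime // pdiv_dvd.
    split=> //; apply: NM; first exact: pdiv_prime.
    by apply: nN; [apply: pdiv_prime|apply: pdiv_dvd].
  have Pg : P (gcdn n M).
    by apply: (Pdown n) => // p pp /dvdn_trans; apply; apply: dvdn_gcdl.
  pose Q c := `[< [/\ c %| M, P c & gcdn n M %| c] >].
  have exQ : exists c, Q c.
    by exists (gcdn n M); apply: asboolT; split=> //; apply: dvdn_gcdr.
  have ubQ c : Q c -> c <= M by move=> /asboolP[cM _ _]; apply: dvdn_leq.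
  case: (ex_maxnP exQ ubQ) => c /asboolP[cM Pc gc] cmax; exists c.
    split=> // c' c'M Pc' cc'; apply/eqP.
    rewrite eqn_leq (dvdn_leq _ cc') ?(dvdn_gt0 M0) //.
    rewrite cmax //; apply: asboolT; split=> //; exact: dvdn_trans gc cc'.
  by move=> p pp pn; apply: dvdn_trans (gP p pp pn) gc.
pose I k := forall n, mx n -> 1 < gcdn k n.
have [|k k0 Ik n mn|k l Il n mn|G Gc GI] := @realize_periods I M M0.
- by move=> n mn; have [/gcdn_idPr -> /Pb[]] := mn.
- by have [/gcdn_idPr nM _ _] := mn; rewrite -gcdnA nM; apply: Ik.
- have n0 := mx0 n mn; have /(gcdn_gt1P _ n0)[p [pp pl pn]] := Il n mn.
  by apply/(gcdn_gt1P _ n0); exists p; split=> //; apply: dvdn_mull.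
exists G => n n1; rewrite (cyclic_belowP Gc n1); split=> [[m [m0 nm mp]]|Pn].
  (* Some maximal [n2] is coprime to the nonperiod [m]. As [m * p] is a period, it shares a prime
     with [n2], which must be [p]. *)
  have [n2 mn2 c2] : exists2 n2, mx n2 & ~ 1 < gcdn m n2.
    apply: contrapT => none; apply: nm; apply/GI => // n2 mn2.
    by apply: contrapT => c2; apply: none; exists n2.
  have n20 := mx0 n2 mn2; have [_ Pn2 _] := mn2; apply: (Pdown n2) => // p pp pn.
  have mp0 : 0 < m * p by rewrite muln_gt0 m0 prime_gt0.
  have /(GI _ mp0)/(_ n2 mn2)/(gcdn_gt1P _ n20)[q [qp qmp qn2]] := mp p pp pn.
  move: qmp; rewrite Euclid_dvdM // => /orP[qm|].
    by case: c2; apply/(gcdn_gt1P _ n20); exists q.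
  by rewrite dvdn_prime2 // => /eqP <-.
have [n1' mn1 nn1] := extend n Pn; have n1'0 := mx0 n1' mn1.
have [n1M Pn1 _] := mn1; have /dvdnP[m Em] := n1M.
have m0 : 0 < m by move: M0; rewrite Em muln_gt0 => /andP[].
exists m; split=> //.
  move=> /(GI _ m0)/(_ n1' mn1)/(gcdn_gt1P _ n1'0)[q [qp qm qn]].
  by have := sqM q qp; rewrite Em dvdn_mul.
move=> p pp pn; have mp0 : 0 < m * p by rewrite muln_gt0 m0 prime_gt0.
(* A maximal [n2] coprime to [m * p] would divide [M = m * n1'], hence [n1'], and so equal it; but
   [p] divides [n1']. *)
apply/(GI _ mp0) => n2 mn2; have n20 := mx0 n2 mn2; apply: contrapT => nc.
have cop : coprime n2 m.
  apply: contrapT => /negP ncop; apply: nc; apply/(gcdn_gt1P _ n20).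
  have : 1 < gcdn m n2 by rewrite ltn_neqAle eq_sym gcdnC ncop gcdn_gt0 n20.
  by move=> /(gcdn_gt1P _ n20)[q [qp qm qn2]]; exists q; split=> //; apply: dvdn_mulr.
have [n2M _ max2] := mn2.
have n2n1 : n2 %| n1' by move: n2M; rewrite Em Gauss_dvdr.
apply: nc; apply/(gcdn_gt1P _ n20); exists p; split=> //; first exact: dvdn_mull.
by rewrite -(max2 n1') //; apply: nn1.
Qed.

(** The complete graph on three vertices is loopless, yet any permutation digraph it maps to has a
    fixed point: two vertices with a common predecessor get the same image, and they are
    adjacent. *)
Lemma trivial_exists : exists G : smooth_digraph, trivial_digraph G.
Proof.
pose K := Digraph (fun x y : 'I_3 => x != y) (inhabits ord0).
have Ksm : smooth K.
  by move=> x; split; [exists (ordS x)|exists (ordS x)]; rewrite /= ?(eq_sym x);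
    case: x => -[|[|[|]]].
exists (SmoothDigraph Ksm); have [//|] := trivial_or_cyclic Ksm.
move=> [X [p [inh [p_inj [[g gE] [h hE]]]]]].
have gp (x y : 'I_3) : x != y -> g y = p (g x) by move=> xy; apply/eqP/(gE x y).
pose a : 'I_3 := ord0; pose b : 'I_3 := ordS a; pose c : 'I_3 := ordS b.
have Ebc : g b = g c by rewrite (gp a b) // (gp a c).
have := hE (g b) (g c); rewrite /= (gp b c) // eqxx -(gp b c) // Ebc => /(_ isT).
by rewrite eqxx.
Qed.

(** * The lattice *)

Definition class_of (G : smooth_digraph) : smooth_digraph_class :=
  exist _ (pp_class G) (ex_intro _ G erefl).

Lemma class_ofP (c : smooth_digraph_class) : exists G, c = class_of G.
Proof. by case: c => c [G cG]; exists G; apply: eq_exist. Qed.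

Lemma class_leE G H : class_le (class_of G) (class_of H) <-> minion_hom G H.
Proof.
split=> [[G' [H' [/= EG EH /pp_constructsP GH]]]|/pp_constructsP GH]; last by exists G, H.
have refl K : pp_class K K by split; apply/pp_constructsP/minion_hom_refl.
have [/pp_constructsP GG' _] : pp_class G G' by rewrite EG.
have [/pp_constructsP HH' _] : pp_class H' H by rewrite -EH.
exact: minion_hom_trans GG' (minion_hom_trans GH HH').
Qed.

Definition class_below (c : smooth_digraph_class) n : Prop :=
  class_le c (class_of (prime_cycles n)).

Lemma class_belowE G n : class_below (class_of G) n <-> below G n.
Proof. exact: class_leE. Qed.

Lemma class_le_trans c d e : class_le c d -> class_le d e -> class_le c e.
Proof.
have [[[G ->] [H ->]] [K ->]] := (class_ofP c, class_ofP d, class_ofP e).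
by rewrite !class_leE; apply: minion_hom_trans.
Qed.

Lemma class_le_order : Relation_Definitions.order smooth_digraph_class class_le.
Proof.
split=> [c|c d e|c d].
- by have [G ->] := class_ofP c; apply/class_leE/minion_hom_refl.
- exact: class_le_trans.
have [[G ->] [H ->]] := (class_ofP c, class_ofP d).
move=> /class_leE GH /class_leE HG; apply: eq_exist => /=.
apply: funext => K; apply: propext; rewrite /pp_class !pp_constructsP.
by split=> -[? ?]; split; apply: minion_hom_trans; eassumption.
Qed.

Lemma class_leP c d : class_le c d <->
  forall n, 1 < n -> class_below d n -> class_below c n.
Proof.
have [[G ->] [H ->]] := (class_ofP c, class_ofP d).
split=> [cd n n1|HG]; first exact: class_le_trans.
apply/class_leE/separation; try exact: smooth_graphP.
by move=> n n1; rewrite -!class_belowE; apply: HG.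
Qed.

Lemma class_ext c d : (forall n, 1 < n -> class_below c n <-> class_below d n) ->
  c = d.
Proof.
move=> cd; case: class_le_order => _ _; apply; apply/class_leP => n n1.
  by move/(cd n n1).
by move/(cd n n1).
Qed.

Definition bounded_below (c : smooth_digraph_class) : Prop :=
  exists2 N, 0 < N &
    forall n, 1 < n -> class_below c n -> forall p, prime p -> p %| n -> p %| N.

Lemma least_or_bounded c : (forall d, class_le c d) \/ bounded_below c.
Proof.
have [G ->] := class_ofP c.
have [t|Gc] := trivial_or_cyclic (smooth_graphP (s := G)).
  by left=> d; have [H ->] := class_ofP d; apply/class_leE/trivial_minion_hom.
right; have [N N0 Nb] := cyclic_below_bounded Gc; exists N => // n n1.
by rewrite class_belowE; apply: Nb.
Qed.

Lemma least_exists : exists c, forall d, class_le c d.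
Proof.
have [G t] := trivial_exists; exists (class_of G) => d.
by have [H ->] := class_ofP d; apply/class_leE/trivial_minion_hom.
Qed.

Lemma class_below_down c n n' : 1 < n -> 1 < n' ->
  (forall p, prime p -> p %| n' -> p %| n) -> class_below c n -> class_below c n'.
Proof.
have [G ->] := class_ofP c; rewrite !class_belowE.
exact: below_down (smooth_graphP (s := G)).
Qed.

Lemma realize_class (P : nat -> Prop) N : 0 < N ->
  (forall n, 1 < n -> P n -> forall p, prime p -> p %| n -> p %| N) ->
  (forall n n', 1 < n -> 1 < n' -> (forall p, prime p -> p %| n' -> p %| n) ->
     P n -> P n') ->
  exists c, forall n, 1 < n -> class_below c n <-> P n.
Proof.
move=> N0 Pb Pdown.
have [n [n1 Pn]|n n' [n1 Pn] n'1 sub|G GP] :=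
  @realize_below (fun n => 1 < n /\ P n) N N0.
- by split=> //; apply: Pb.
- by split=> //; apply: (Pdown n).
exists (class_of G) => n n1; rewrite class_belowE GP //.
by split=> [[]|].
Qed.

(** The infimum has the union of the families. If that union is unbounded, every lower bound is
    unbounded as well and therefore least. *)
Lemma glb_exists (S : smooth_digraph_class -> Prop) : exists c, is_glb class_le S c.
Proof.
have [[N N0 Nb]|unb] := pselect (exists2 N, 0 < N & forall n, 1 < n ->
    (exists2 c, S c & class_below c n) -> forall p, prime p -> p %| n -> p %| N).
  have [n n' n1 n'1 sub [c Sc cn]|w wP] := realize_class N0 Nb.
    by exists c => //; apply: class_below_down cn.
  exists w; split=> [c Sc|z zS]; apply/class_leP => n n1.
    by move=> cn; apply/wP => //; exists c.
  by move=> /(wP n n1)[c Sc]; apply: class_le_trans (zS c Sc).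
have [w w_least] := least_exists; exists w; split=> // z zS.
have [//|[N N0 Nb]] := least_or_bounded z; case: unb; exists N => // n n1 [c Sc cn].
by apply: Nb => //; apply: class_le_trans (zS c Sc) cn.
Qed.

Lemma lub_exists (S : smooth_digraph_class -> Prop) : exists c, is_lub class_le S c.
Proof.
have [w [wl wg]] := glb_exists (fun u => forall c, S c -> class_le c u).
by exists w; split=> [c Sc|z zS]; [apply: wg => u; apply|apply: wl].
Qed.

(** Unlike [glb_exists], this describes the family of the meet pointwise, as distributivity
    requires. *)
Lemma meet_exists x y : exists w, forall n, 1 < n ->
  class_below w n <-> class_below x n \/ class_below y n.
Proof.
have [xl|[N N0 Nb]] := least_or_bounded x.
  by exists x => n n1; split=> [|_]; [left|apply: xl].
have [yl|[M M0 Mb]] := least_or_bounded y.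
  by exists y => n n1; split=> [|_]; [right|apply: yl].
apply: (@realize_class _ (N * M)); first by rewrite muln_gt0 N0.
  move=> n n1 [xn|yn] p pp pn; first by rewrite dvdn_mulr ?(Nb n).
  by rewrite dvdn_mull ?(Mb n).
by move=> n n' n1 n'1 sub [|] /(class_below_down n1 n'1 sub); [left|right].
Qed.

Lemma join_exists x y : exists w, forall n, 1 < n ->
  class_below w n <-> class_below x n /\ class_below y n.
Proof.
have [xl|[N N0 Nb]] := least_or_bounded x.
  by exists y => n n1; split=> [yn|[]//]; split=> //; apply: xl.
apply: (realize_class N0); first by move=> n n1 [/(Nb n n1)].
by move=> n n' n1 n'1 sub [xn yn]; split; apply: class_below_down sub _.
Qed.

Theorem corollary7p2 :
  complete_lattice class_le /\ distributive_lattice class_le.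
Proof.
split; split; try exact: class_le_order.
  by move=> S; split; [apply: lub_exists|apply: glb_exists].
pose meet x y := sval (cid (meet_exists x y)).
pose join x y := sval (cid (join_exists x y)).
have meetP x y n : 1 < n ->
    class_below (meet x y) n <-> class_below x n \/ class_below y n.
  exact: (svalP (cid (meet_exists x y))).
have joinP x y n : 1 < n ->
    class_below (join x y) n <-> class_below x n /\ class_below y n.
  exact: (svalP (cid (join_exists x y))).
exists meet, join; split=> [x y|x y|x y z].
- split=> [z [->|->]|z zxy]; apply/class_leP => n n1.
  + by move=> xn; apply/meetP => //; left.
  + by move=> yn; apply/meetP => //; right.
  by move=> /(meetP _ _ _ n1)[]; apply: class_le_trans; apply: zxy; [left|right].
- split=> [z [->|->]|z zxy]; apply/class_leP => n n1.
  + by move=> /(joinP _ _ _ n1)[].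
  + by move=> /(joinP _ _ _ n1)[].
  move=> zn; apply/joinP => //; split; apply: class_le_trans zn; apply: zxy.
    by left.
  by right.
(* Through the families, the law becomes distributivity of disjunction over conjunction. *)
apply: class_ext => n n1.
rewrite (meetP _ _ _ n1) !(joinP _ _ _ n1) !(meetP _ _ _ n1); tauto.
Qed.
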